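(* Let $\Gamma$ be a hyperbolic group, let $X$ be a Gromov-hyperbolic, proper, geodesic metric space and $G=\mathrm{Isom}(X)$, and let $A\subset\Gamma$ be testable. Then $S_A(\Gamma,G)$ is an open set of discontinuity of $X(\Gamma,G)$ for the action of $\mathrm{Out}(\Gamma)$, i.e. it is open, $\mathrm{Out}(\Gamma)$-invariant, and for every compact $R\subset S_A(\Gamma,G)$ the set $\{\phi\in\mathrm{Out}(\Gamma)\mid \phi(R)\cap R\neq\emptyset\}$ is finite.
   Context: Fix a finite generating set $S$; $l_S(\gamma)$ is the translation length of $\gamma$ acting on the Cayley graph $C_S(\Gamma)$. $A$ is testable if it is invariant under all automorphisms of $\Gamma$ and for every sequence $(\phi_n)$ of distinct elements of $\mathrm{Out}(\Gamma)$ there is $a\in A$ with $\limsup_n l_S(\phi_n(a))=\infty$. $G$ has the compact-open topology; $X(\Gamma,G)=\mathrm{Hom}(\Gamma,G)/\mathrm{Inn}(G)$ with the quotient of the topology induced from $G^{|S|}$; $\mathrm{Out}(\Gamma)$ acts via $\varphi\cdot\rho=\rho\circ\varphi^{-1}$. Orbit map $\tau_{\rho,x}$: $\rho$-equivariant, $\gamma\mapsto\rho(\gamma)x$ on vertices, edges to geodesic segments. For infinite order $a$, $L_S(a)$ is the set of geodesics of $C_S(\Gamma)$ between the fixed points $a^\pm\in\partial C_S(\Gamma)$. $\rho$ is $A$-stable if there are $K\geqslant1,C\geqslant0,x\in X$ with $\tau_{\rho,x}(l)$ a $(K,C)$ quasi-geodesic for all $l\in L_S(a)$, all infinite order $a\in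 A$; $S_A(\Gamma,G)$ is the set of conjugacy classes of $A$-stable representations. *)

(* Defs.v *)
From Stdlib Require Import Reals List ZArith ClassicalEpsilon.
Open Scope R_scope.

Record Grp := {
  gc :> Type;
  gmul : gc -> gc -> gc;
  ginv : gc -> gc;
  gone : gc;
  gassoc : forall x y z, gmul x (gmul y z) = gmul (gmul x y) z;
  gone_l : forall x, gmul gone x = x;
  gone_r : forall x, gmul x gone = x;
  ginv_l : forall x, gmul (ginv x) x = gone;
  ginv_r : forall x, gmul x (ginv x) = gone }.

Arguments gmul {_}. Arguments ginv {_}. Arguments gone {_}.

Section Group.
Variable G : Grp.

Fixpoint gpow (a : G) (n : nat) : G :=
  match n with O => gone | S k => gmul a (gpow a k) end.

Definition infinite_order (a : G) : Prop := forall n, (1 <= n)%nat -> gpow a n <> gone.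

Definition is_hom (f : G -> G) : Prop := forall x y, f (gmul x y) = gmul (f x) (f y).

Definition is_aut (f : G -> G) : Prop :=
  is_hom f /\ (forall x y, f x = f y -> x = y) /\ (forall y, exists x, f x = y).

(* equality in Out(G) = Aut(G)/Inn(G) *)
Definition out_eq (f g : G -> G) : Prop :=
  exists h : G, forall x, f x = gmul h (gmul (g x) (ginv h)).

Definition letter (b : bool) (s : G) : G := if b then s else ginv s.

Fixpoint wprod (w : list (bool * G)) : G :=
  match w with nil => gone | (b, s) :: w' => gmul (letter b s) (wprod w') end.

Definition word_over (S : list G) (w : list (bool * G)) : Prop :=
  forall p, In p w -> In (snd p) S.

Definition generates (S : list G) : Prop :=
  forall g, exists w, word_over S w /\ wprod w = g.

Definition wl_le (S : list G) (g : G) (n : nat) : Prop :=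
  exists w, word_over S w /\ wprod w = g /\ (length w <= n)%nat.

Definition wlen (S : list G) (g : G) : nat :=
  epsilon (inhabits 0%nat)
    (fun n => wl_le S g n /\ forall m, wl_le S g m -> (n <= m)%nat).

Definition dS (S : list G) (g h : G) : R := INR (wlen S (gmul (ginv g) h)).

Definition gpS (S : list G) (x y w : G) : R :=
  (dS S x w + dS S y w - dS S x y) / 2.

Definition hyperbolic_group (S : list G) : Prop :=
  exists delta : R, forall x y z w,
    gpS S x z w >= Rmin (gpS S x y w) (gpS S y z w) - delta.

(* translation length: l_S(g) >= M, where l_S(g) = inf_x d(x, g x) *)
Definition trlen_ge (S : list G) (g : G) (M : R) : Prop :=
  forall x, dS S x (gmul g x) >= M.

Definition testable (S : list G) (A : G -> Prop) : Prop :=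
  (forall phi, is_aut phi -> forall a, A a -> A (phi a)) /\
  (forall phis : nat -> G -> G,
     (forall n, is_aut (phis n)) ->
     (forall n m, n <> m -> ~ out_eq (phis n) (phis m)) ->
     exists a, A a /\
       forall M : R, forall N : nat, exists n, (N <= n)%nat /\ trlen_ge S (phis n a) M).

(* two sequences of vertices converge to the same point of the Gromov boundary *)
Definition same_end (S : list G) (u v : nat -> G) : Prop :=
  forall M : R, exists N : nat, forall n m, (N <= n)%nat -> (N <= m)%nat ->
    gpS S (u n) (v m) gone >= M.

(* L_S(a): bi-infinite geodesics (vertex sequences) from a^- to a^+ *)
Definition in_LS (S : list G) (a : G) (l : Z -> G) : Prop :=
  (forall m n : Z, dS S (l m) (l n) = IZR (Z.abs (m - n))) /\
  same_end S (fun n => l (Z.of_nat n)) (gpow a) /\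
  same_end S (fun n => l (- Z.of_nat n)%Z) (fun k => ginv (gpow a k)).

End Group.

Record MSpace := {
  pt :> Type;
  dist : pt -> pt -> R;
  dist_refl : forall x, dist x x = 0;
  dist_eq0 : forall x y, dist x y = 0 -> x = y;
  dist_sym : forall x y, dist x y = dist y x;
  dist_tri : forall x y z, dist x z <= dist x y + dist y z }.

Arguments dist {_}.

Definition compact_wrt {T : Type} (opn : (T -> Prop) -> Prop) (K : T -> Prop) : Prop :=
  forall F : (T -> Prop) -> Prop,
    (forall U, F U -> opn U) ->
    (forall x, K x -> exists U, F U /\ U x) ->
    exists l : list (T -> Prop),
      (forall U, In U l -> F U) /\ (forall x, K x -> exists U, In U l /\ U x).

Section Metric.
Variable X : MSpace.

Definition mopen (U : X -> Prop) : Prop :=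
  forall x, U x -> exists eps, eps > 0 /\ forall y, dist x y < eps -> U y.

Definition mcompact (K : X -> Prop) : Prop := compact_wrt mopen K.

Definition proper_space : Prop :=
  forall x (r : R), mcompact (fun y => dist x y <= r).

Definition geodesic_space : Prop :=
  forall x y : X, exists c : R -> X, c 0 = x /\ c (dist x y) = y /\
    forall s t, 0 <= s <= dist x y -> 0 <= t <= dist x y -> dist (c s) (c t) = Rabs (s - t).

Definition gp (x y w : X) : R := (dist x w + dist y w - dist x y) / 2.

Definition gromov_hyperbolic : Prop :=
  exists delta : R, forall x y z w, gp x z w >= Rmin (gp x y w) (gp y z w) - delta.

Definition isom (f : X -> X) : Prop :=
  (forall x y, dist (f x) (f y) = dist x y) /\ (forall y, exists x, f x = y).

End Metric.

Arguments mopen {_}. Arguments mcompact {_}. Arguments isom {_}.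

Section Reps.
Variables (Gam : Grp) (S : list Gam) (X : MSpace).

Definition Rep := Gam -> X -> X.

Definition is_rep (rho : Rep) : Prop :=
  (forall g, isom (rho g)) /\ (forall g h x, rho (gmul g h) x = rho g (rho h x)).

(* topology on Hom(Gam,G), induced from G^{|S|} with G carrying the compact-open
   topology: generated by the subbasic sets {rho | rho(s)(K) c U},
   s in S, K compact, U open. *)
Definition subbasic (t : Gam * (X -> Prop) * (X -> Prop)) : Prop :=
  let '(s, K, U) := t in In s S /\ mcompact K /\ mopen U.

Definition sat_sub (t : Gam * (X -> Prop) * (X -> Prop)) (rho : Rep) : Prop :=
  let '(s, K, U) := t in forall x, K x -> U (rho s x).

Definition hom_open (O : Rep -> Prop) : Prop :=
  forall rho, is_rep rho -> O rho ->
    exists l : list (Gam * (X -> Prop) * (X -> Prop)),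
      (forall t, In t l -> subbasic t /\ sat_sub t rho) /\
      forall rho', is_rep rho' -> (forall t, In t l -> sat_sub t rho') -> O rho'.

Definition conj_rep (rho rho' : Rep) : Prop :=
  exists g : X -> X, isom g /\ forall h x, rho' h (g x) = g (rho h x).

(* subsets of X(Gam,G) = Hom/Inn are represented by saturated subsets of Hom *)
Definition saturated (R : Rep -> Prop) : Prop :=
  (forall rho, R rho -> is_rep rho) /\
  (forall rho rho', is_rep rho -> is_rep rho' -> conj_rep rho rho' -> R rho -> R rho').

Definition quot_open (O : Rep -> Prop) : Prop := saturated O /\ hom_open O.

Definition quot_compact (R : Rep -> Prop) : Prop := compact_wrt quot_open R.

Definition quasi_geod (K C : R) (p : Z -> X) : Prop :=
  forall m n : Z,
    / K * IZR (Z.abs (m - n)) - C <= dist (p m) (p n) <= K * IZR (Z.abs (m - n)) + C.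

Definition A_stable (A : Gam -> Prop) (rho : Rep) : Prop :=
  exists (K C : R) (x : X), K >= 1 /\ C >= 0 /\
    forall a, A a -> infinite_order Gam a ->
      forall l, in_LS Gam S a l -> quasi_geod K C (fun n => rho (l n) x).

(* S_A(Gam,G), as a saturated subset of Hom *)
Definition S_A (A : Gam -> Prop) (rho : Rep) : Prop :=
  is_rep rho /\ exists rho', is_rep rho' /\ conj_rep rho' rho /\ A_stable A rho'.

End Reps.

(* Main.v *)
From Stdlib Require Import Reals List ZArith Lra Lia Psatz Classical ClassicalEpsilon.
Require Import Defs.
Local Open Scope R_scope.

(** Everything rests on a local-to-global principle for quasi-geodesics.  A path
    of length at most [2^k] cannot stay far from a geodesic with the same
    endpoints by more than [k delta], so a quasi-geodesic of length [n] stays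
    [O(log n)]-close to the geodesic; sampled at a large scale it becomes a
    broken geodesic with long pieces and comparatively small turning products,
    which forces linear progress.

    Openness: a representation that displaces some base point almost as [rho]
    does, for all group elements of word length at most [L], maps the geodesics
    of [L_S(a)] to local, hence global, quasi-geodesics.  Such conditions
    define conjugation-invariant open sets with uniform constants, so compact
    sets are uniformly stable.

    Invariance: an automorphism maps a geodesic of [L_S(a)] to a quasi-geodesic,
    and a limit of geodesic segments gives a geodesic of [L_S(phi(a))] near it.

    Discontinuity: if the translation length [N] of [b] is large, the translates
    of a segment [[x, b x]] of minimal length form an [N]-local geodesic.  So
    [b] has an axis, and stability bounds [N] by a multiple of the displacement
    of any point under [rho(b)].  For [b = phi_n(a)] with [rho_n = rho_n' o phi_n]
    in a compact set, that displacement is the one of [rho_n(a)], which is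
    bounded in [n]; this contradicts testability. *)

Lemma choice {T U : Type} (P : T -> U -> Prop) :
  (forall x, exists y, P x y) -> exists f, forall x, P x (f x).
Proof.
  intros H. exists (fun x => proj1_sig (constructive_indefinite_description _ (H x))).
  intros x. apply proj2_sig.
Qed.

(** * Quasi-geodesics in hyperbolic spaces *)

Section HyperbolicSpace.
Variable Y : MSpace.

Lemma dist_nonneg (x y : Y) : 0 <= dist x y.
Proof.
  pose proof (dist_tri Y x y x) as H. rewrite dist_refl, (dist_sym Y y x) in H. lra.
Qed.

Lemma gp_nonneg (x y w : Y) : 0 <= gp Y x y w.
Proof.
  unfold gp. pose proof (dist_tri Y x w y). rewrite (dist_sym Y w y) in *. lra.
Qed.

Lemma gp_sym (x y w : Y) : gp Y x y w = gp Y y x w.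
Proof. unfold gp. rewrite (dist_sym Y x y). lra. Qed.

Lemma gp_base_l (x y : Y) : gp Y x y x = 0.
Proof. unfold gp. rewrite dist_refl, (dist_sym Y y x). lra. Qed.

Lemma gp_move_base (x y w w' : Y) : gp Y x y w <= gp Y x y w' + dist w w'.
Proof.
  unfold gp.
  pose proof (dist_tri Y x w' w). pose proof (dist_tri Y y w' w).
  rewrite (dist_sym Y w' w) in *. lra.
Qed.

Lemma gp_move_l (x x' y w : Y) : gp Y x y w <= gp Y x' y w + dist x x'.
Proof.
  unfold gp.
  pose proof (dist_tri Y x x' w). pose proof (dist_tri Y x' x y).
  rewrite (dist_sym Y x' x) in *. lra.
Qed.

Lemma gp_move_r (x y y' w : Y) : gp Y x y w <= gp Y x y' w + dist y y'.
Proof. rewrite (gp_sym x y), (gp_sym x y'). apply gp_move_l. Qed.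

Definition hyp_with (delta : R) : Prop :=
  0 <= delta /\
  forall x y z w : Y, gp Y x z w >= Rmin (gp Y x y w) (gp Y y z w) - delta.

Lemma hyp_with_intro :
  gromov_hyperbolic Y -> exists delta, hyp_with delta.
Proof.
  intros [d Hd]. exists (Rmax d 0). split; [apply Rmax_r|].
  intros x y z w. specialize (Hd x y z w). pose proof (Rmax_l d 0). lra.
Qed.

(* A common weakening of geodesicity that also holds for the vertex set of a Cayley graph. *)
Definition chain_geodesic : Prop :=
  forall x y : Y, exists (N : nat) (q : nat -> Y),
    q 0%nat = x /\ q N = y /\
    (forall i, (i < N)%nat -> dist (q i) (q (S i)) <= 1) /\
    (forall i, (i <= N)%nat -> dist x (q i) + dist (q i) y = dist x y).

Lemma geodesic_chain : geodesic_space Y -> chain_geodesic.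
Proof.
  intros HG x y. destruct (HG x y) as (c & c0 & c1 & Hc).
  pose proof (dist_nonneg x y) as Hd.
  destruct (INR_unbounded (dist x y)) as [N HN].
  exists N, (fun i => c (Rmin (INR i) (dist x y))).
  assert (Hin : forall i, 0 <= Rmin (INR i) (dist x y) <= dist x y).
  { intros i. pose proof (pos_INR i). split; [apply Rmin_glb; lra | apply Rmin_r]. }
  split; [| split; [| split]].
  - simpl. rewrite Rmin_left by lra. exact c0.
  - rewrite Rmin_right by lra. exact c1.
  - intros i _. rewrite Hc by apply Hin. rewrite S_INR. pose proof (pos_INR i).
    unfold Rmin. repeat destruct Rle_dec; unfold Rabs; destruct Rcase_abs; lra.
  - intros i _. pose proof (Hin i) as H. set (m := Rmin (INR i) (dist x y)) in *.
    pose proof (Hc 0 m ltac:(lra) H) as E1. pose proof (Hc m (dist x y) H ltac:(lra)) as E2.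
    rewrite c0, Rabs_left1 in E1 by lra. rewrite c1, Rabs_left1 in E2 by lra. lra.
Qed.

Variable delta : R.
Hypothesis Hyp : hyp_with delta.

(** Gromov's inequality at [w], doubled: the distances to the base point regroup into the symmetric
    condition on the three pairings of four points. *)
Lemma four_point (x y z w : Y) :
  dist x z + dist y w <= Rmax (dist x y + dist z w) (dist y z + dist x w) + 2 * delta.
Proof.
  destruct Hyp as [_ H]. specialize (H x y z w). unfold gp in H.
  unfold Rmin in H. destruct Rle_dec in H;
  pose proof (Rmax_l (dist x y + dist z w) (dist y z + dist x w));
  pose proof (Rmax_r (dist x y + dist z w) (dist y z + dist x w)); lra.
Qed.

(** * Broken geodesics with long pieces and small turning products *)

Section Broken.
Variables (x : nat -> Y) (n : nat) (a ell : R).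
Hypothesis Hell : 2 * a + 3 * delta + 1 <= ell.
Hypothesis Hlong : forall i, (i < n)%nat -> dist (x i) (x (S i)) >= ell.
Hypothesis Hturn : forall i, (S i < n)%nat -> gp Y (x i) (x (S (S i))) (x (S i)) <= a.

(** Induction on [i]. A small product at [x i] makes the product of [x i] and [x 0] at [x (S i)]
    large, at least [ell - a - delta]. Since the turning product there is at most [a], the
    hyperbolic inequality must bound the other term, the product of [x 0] and [x (S (S i))]. *)
Lemma broken_turn_start (a_pos : 0 <= a) i :
  (i < n)%nat -> gp Y (x 0%nat) (x (S i)) (x i) <= a + delta.
Proof.
  destruct Hyp as [Hd H].
  induction i as [|i IH]; intros Hi.
  - rewrite gp_base_l. lra.
  - specialize (IH ltac:(lia)). specialize (Hturn i Hi). specialize (Hlong i ltac:(lia)).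
    pose proof (H (x i) (x 0%nat) (x (S (S i))) (x (S i))) as H4.
    assert (gp Y (x i) (x 0%nat) (x (S i)) = dist (x i) (x (S i)) - gp Y (x 0%nat) (x (S i)) (x i)) as E.
    { unfold gp. rewrite (dist_sym Y (x i) (x 0%nat)), (dist_sym Y (x (S i)) (x i)). lra. }
    rewrite E in H4. unfold Rmin in H4. destruct Rle_dec in H4; lra.
Qed.

(** Each piece increases the distance from [x 0] by at least [ell - 2 * (a + delta)], which is at
    least 1. *)
Lemma broken_dist (a_pos : 0 <= a) i : (i <= n)%nat -> INR i <= dist (x 0%nat) (x i).
Proof.
  destruct Hyp as [Hd H].
  induction i as [|i IH]; intros Hi.
  - rewrite dist_refl. simpl. lra.
  - specialize (IH ltac:(lia)). pose proof (broken_turn_start a_pos i ltac:(lia)) as HT.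
    specialize (Hlong i ltac:(lia)). rewrite S_INR. unfold gp in HT.
    rewrite (dist_sym Y (x (S i)) (x i)) in HT. lra.
Qed.
End Broken.

(** The broken path stays near the geodesic between its ends. At [x (S j)] the product of [x j] with
    [x n] is small and that with [x 0] is large, so the product of [x 0] and [x n] is small. *)
Lemma broken_middle (x : nat -> Y) n a ell i :
  0 <= a -> 2 * a + 3 * delta + 1 <= ell ->
  (forall i, (i < n)%nat -> dist (x i) (x (S i)) >= ell) ->
  (forall i, (S i < n)%nat -> gp Y (x i) (x (S (S i))) (x (S i)) <= a) ->
  (i <= n)%nat -> gp Y (x 0%nat) (x n) (x i) <= a + 2 * delta.
Proof.
  intros Ha Hell Hl Ht Hi.
  destruct Hyp as [Hd H].
  destruct i as [|j]; [rewrite gp_base_l; lra|].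
  assert (Hr : gp Y (x n) (x j) (x (S j)) <= a + delta).
  (* The bound seen from the far end is the same lemma for the reversed path. *)
  { pose proof (broken_turn_start (fun i => x (n - i)%nat) n a ell Hell) as B.
    cbv beta in B. rewrite Nat.sub_0_r in B.
    specialize (B ltac:(intros k Hk; replace (n - k)%nat with (S (n - S k)) by lia;
      rewrite dist_sym; apply Hl; lia)).
    specialize (B ltac:(intros k Hk; replace (n - k)%nat with (S (S (n - S (S k)))) by lia;
      replace (n - S k)%nat with (S (n - S (S k))) by lia; rewrite gp_sym; apply Ht; lia)).
    specialize (B Ha (n - S j)%nat ltac:(lia)).
    replace (n - S (n - S j))%nat with j in B by lia.
    replace (n - (n - S j))%nat with (S j) in B by lia. exact B. }
  pose proof (broken_turn_start x n a ell Hell Hl Ht Ha j ltac:(lia)) as Hf.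
  specialize (Hl j ltac:(lia)).
  pose proof (H (x j) (x 0%nat) (x n) (x (S j))) as H4.
  assert (gp Y (x j) (x 0%nat) (x (S j)) = dist (x j) (x (S j)) - gp Y (x 0%nat) (x (S j)) (x j)) as E.
  { unfold gp. rewrite (dist_sym Y (x j) (x 0%nat)), (dist_sym Y (x (S j)) (x j)). lra. }
  rewrite E in H4. rewrite (gp_sym (x j) (x n)) in H4.
  unfold Rmin in H4. destruct Rle_dec in H4; lra.
Qed.

(** Bisect the path: each of the [k] halvings costs one [delta], and a last single step costs
    [J / 2]. At a point [w] of a geodesic between the ends the product is 0, so the path must come
    within [INR k * delta + J / 2] of [w]. *)
Lemma gp_path_far k : forall (x : nat -> Y) n (w : Y) r J,
  (n <= 2 ^ k)%nat -> 0 <= J ->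
  (forall i, (i < n)%nat -> dist (x i) (x (S i)) <= J) ->
  (forall i, (i <= n)%nat -> r <= dist w (x i)) ->
  r - INR k * delta - J / 2 <= gp Y (x 0%nat) (x n) w.
Proof.
  destruct Hyp as [Hd H].
  induction k as [|k IH]; intros x n w r J Hn HJ Hs Hr.
  - simpl in *. destruct n as [|[|n]]; [| |lia].
    + specialize (Hr 0%nat (le_n _)). unfold gp. rewrite dist_refl, (dist_sym Y _ w). lra.
    + pose proof (Hr 0%nat ltac:(lia)). pose proof (Hr 1%nat ltac:(lia)).
      specialize (Hs 0%nat ltac:(lia)). unfold gp.
      rewrite (dist_sym Y _ w), (dist_sym Y (x 1%nat) w). lra.
  - pose proof (Nat.div_mod_eq n 2) as E. pose proof (Nat.mod_upper_bound n 2 ltac:(lia)).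
    set (h := (n / 2)%nat) in *. simpl in Hn.
    pose proof (IH x h w r J ltac:(lia) HJ ltac:(intros; apply Hs; lia) ltac:(intros; apply Hr; lia)) as H1.
    pose proof (IH (fun i => x (h + i)%nat) (n - h)%nat w r J ltac:(lia) HJ) as H2.
    cbv beta in H2. rewrite Nat.add_0_r in H2.
    replace (h + (n - h))%nat with n in H2 by lia.
    specialize (H2 ltac:(intros i Hi; rewrite Nat.add_succ_r; apply Hs; lia) ltac:(intros; apply Hr; lia)).
    pose proof (H (x 0%nat) (x h) (x n) w) as H4. rewrite S_INR.
    unfold Rmin in H4. destruct Rle_dec in H4; lra.
Qed.

(** For [L = n] this is the ordinary quasi-geodesic condition on the indices [0..n]. *)
Definition local_qg (L n : nat) (K C : R) (p : nat -> Y) : Prop :=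
  forall i j, (i <= j)%nat -> (j <= n)%nat -> (j - i <= L)%nat ->
    / K * INR (j - i) - C <= dist (p i) (p j) <= K * INR (j - i) + C.

Lemma local_qg_shift L n K C p m k :
  (m + k <= n)%nat -> local_qg L n K C p -> local_qg L k K C (fun i => p (m + i)%nat).
Proof.
  intros Hm H i j Hij Hj HL.
  replace (j - i)%nat with ((m + j) - (m + i))%nat by lia.
  apply H; lia.
Qed.

Lemma first_exit (P : nat -> Prop) N :
  P 0%nat -> ~ P N -> exists t, (t < N)%nat /\ P t /\ ~ P (S t).
Proof.
  intros H0. induction N as [|N IH]; intros HN; [contradiction|].
  destruct (classic (P N)) as [HP|HP].
  - exists N. auto.
  - destruct (IH HP) as (t & Ht & H). exists t. split; [lia|exact H].
Qed.

Hypothesis Geo : chain_geodesic.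

(** Here [c] is the distance from points of the geodesic to the path, [K * (2 * c + 1 + C)] bounds
    the number of path steps around a given point between two places close to the geodesic, and the
    remaining terms bound the way back from that point. *)
Definition morse_log (K C : R) (k : nat) : R :=
  let c := INR k * delta + K + C in K * (K * (2 * c + 1 + C)) + C + c.

(** First the geodesic lies near the path, by [gp_path_far]. Then some point of the geodesic is near
    the path both before and after [i]; the lower quasi-geodesic bound makes this stretch short, so
    [p i] is near the geodesic as well. *)
Lemma quasi_geodesic_log_morse K C k n (p : nat -> Y) i :
  1 <= K -> 0 <= C -> (n <= 2 ^ k)%nat -> local_qg n n K C p -> (i <= n)%nat ->
  gp Y (p 0%nat) (p n) (p i) <= morse_log K C k.
Proof.
  intros HK HC Hn Hp Hi. unfold morse_log.
  set (c := INR k * delta + K + C).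
  assert (Hd : 0 <= delta) by apply Hyp.
  pose proof (pos_INR k) as Hk.
  assert (Hc : 1 <= c) by (unfold c; nra).
  destruct (Geo (p 0%nat) (p n)) as (N & q & q0 & qN & qs & qb).
  (* If the path stayed at distance [c] from [q t], the product at [q t] would be at least
     [(K + C) / 2 > 0], whereas it vanishes on a geodesic. *)
  assert (near : forall t, (t <= N)%nat -> exists j, (j <= n)%nat /\ dist (q t) (p j) <= c).
  { intros t Ht. apply NNPP. intros Hno.
    assert (far : forall j, (j <= n)%nat -> c <= dist (q t) (p j)).
    { intros j Hj. destruct (Rle_dec c (dist (q t) (p j))); auto.
      exfalso. apply Hno. exists j. split; [auto|lra]. }
    pose proof (gp_path_far k p n (q t) c (K + C) Hn ltac:(lra)) as G.
    specialize (G ltac:(intros j Hj; specialize (Hp j (S j) ltac:(lia) ltac:(lia) ltac:(lia));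
      replace (S j - j)%nat with 1%nat in Hp by lia; simpl in Hp; lra) far).
    specialize (qb t Ht). unfold gp in G. rewrite (dist_sym Y (p n) (q t)) in G.
    unfold c in G. lra. }
  (* Follow [q] while it is near the part of the path up to [i]. Just after it leaves that part it
     is near the later part; the extra 1 is one step of [q]. *)
  assert (pinch : exists t j j', (t <= N)%nat /\ (j <= i)%nat /\ (i <= j')%nat /\ (j' <= n)%nat
     /\ dist (q t) (p j) <= c /\ dist (q t) (p j') <= c + 1).
  { set (P := fun t => exists j, (j <= i)%nat /\ dist (q t) (p j) <= c).
    assert (P0 : P 0%nat). { exists 0%nat. rewrite q0, dist_refl. split; [lia|lra]. }
    destruct (classic (P N)) as [HN|HN].
    - destruct HN as (j & Hj & Hq). exists N, j, n. rewrite qN, dist_refl in *.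
      repeat split; auto; lra.
    - destruct (first_exit P N P0 HN) as (t & Ht & (j & Hj & Hq) & HS).
      destruct (near (S t) ltac:(lia)) as (j' & Hj' & Hq').
      exists t, j, j'. repeat split; auto; try lia.
      + destruct (Nat.le_gt_cases i j'); auto. exfalso. apply HS. exists j'. split; [lia|auto].
      + pose proof (dist_tri Y (q t) (q (S t)) (p j')). specialize (qs t Ht). lra. }
  destruct pinch as (t & j & j' & Ht & Hj & Hj' & Hjn & D1 & D2).
  pose proof (dist_tri Y (p j) (q t) (p j')) as T. rewrite (dist_sym Y (p j) (q t)) in T.
  pose proof (Hp j j' ltac:(lia) ltac:(lia) ltac:(lia)) as [HL _].
  pose proof (Hp j i ltac:(lia) ltac:(lia) ltac:(lia)) as [_ HU].
  assert (INR (j' - j) <= K * (2 * c + 1 + C)).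
  { apply Rmult_le_reg_l with (/ K). apply Rinv_0_lt_compat; lra.
    rewrite <- Rmult_assoc, Rinv_l by lra. lra. }
  assert (INR (i - j) <= INR (j' - j)) by (apply le_INR; lia).
  pose proof (dist_tri Y (p i) (p j) (q t)) as T2.
  rewrite (dist_sym Y (p i) (p j)), (dist_sym Y (p j) (q t)) in T2.
  pose proof (gp_move_base (p 0%nat) (p n) (p i) (q t)) as G.
  specialize (qb t Ht). unfold gp at 2 in G. rewrite (dist_sym Y (p n) (q t)) in G.
  assert (K * INR (i - j) <= K * (K * (2 * c + 1 + C))) by (apply Rmult_le_compat_l; lra).
  lra.
Qed.

(** Bernoulli's inequality gives [1 + m <= 2 ^ m]; for [j = 2 * m] its square outgrows the linear
    term. *)
Lemma pow2_beats_linear A B : exists j : nat, A * INR j + B <= INR (2 ^ j).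
Proof.
  destruct (INR_unbounded (2 * Rabs A + Rabs B)) as [m Hm].
  exists (2 * m)%nat. rewrite pow_INR, pow_mult, mult_INR. simpl (INR 2).
  replace ((1 + 1) ^ 2) with 4 by ring.
  assert (P : 1 + INR m <= 2 ^ m).
  { pose proof (poly m 1 ltac:(lra)). replace (1 + 1) with 2 in * by ring. lra. }
  replace (4 ^ m) with (2 ^ m * 2 ^ m) by (rewrite <- Rpow_mult_distr; f_equal; ring).
  pose proof (pos_INR m).
  pose proof (Rle_abs A). pose proof (Rle_abs B). pose proof (Rabs_pos A). pose proof (Rabs_pos B).
  nra.
Qed.

(* The logarithmic Morse bound is negligible against the length at a large scale s = 2^j, so the points p(is) form a broken geodesic. *)
Theorem local_to_global K C :
  1 <= K -> 0 <= C ->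
  exists (L : nat) (K' C' D : R), (1 <= L)%nat /\ 1 <= K' /\ 0 <= C' /\ 0 <= D /\
    forall n p, local_qg L n K C p ->
      / K' * INR n - C' <= dist (p 0%nat) (p n) /\
      forall k, (k <= n)%nat -> gp Y (p 0%nat) (p n) (p k) <= D.
Proof.
  intros HK HC.
  assert (Hd : 0 <= delta) by apply Hyp.
  (* The bound is affine in the exponent of the length, so it is eventually beaten by the length
     itself. *)
  assert (Lin : forall k, 0 <= morse_log K C k /\ morse_log K C k = (2 * K * K + 1) * delta * INR k + morse_log K C 0).
  { intros k. unfold morse_log. simpl. split; [|ring].
    pose proof (pos_INR k).
    assert (0 <= INR k * delta) by nra.
    assert (0 <= K * (2 * (INR k * delta + K + C) + 1 + C)) by (apply Rmult_le_pos; lra).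
    assert (0 <= K * (K * (2 * (INR k * delta + K + C) + 1 + C))) by (apply Rmult_le_pos; lra).
    lra. }
  (* These coefficients unfold [K * (2 * a + 3 * delta + 1 + C) <= s], the length requirement on the
     pieces of a broken geodesic with turning bound [a]. *)
  destruct (pow2_beats_linear (K * (2 * ((2 * K * K + 1) * delta)))
    (K * (2 * ((2 * K * K + 1) * delta + morse_log K C 0) + 3 * delta + 1 + C))) as [j Hj].
  set (s := (2 ^ j)%nat) in *. set (a := morse_log K C (S j)).
  assert (Ha : 0 <= a) by apply Lin.
  assert (Hs : (1 <= s)%nat). { unfold s. pose proof (Nat.pow_nonzero 2 j). lia. }
  assert (Hell : 2 * a + 3 * delta + 1 <= / K * INR s - C).
  { assert (K * (2 * a + 3 * delta + 1 + C) <= INR s).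
    { unfold a. rewrite (proj2 (Lin (S j))), S_INR. lra. }
    apply Rmult_le_compat_l with (r := / K) in H; [|left; apply Rinv_0_lt_compat; lra].
    rewrite <- Rmult_assoc, Rinv_l in H by lra. lra. }
  assert (HsR : 1 <= INR s) by (apply (le_INR 1); exact Hs).
  set (J := K * INR s + C).
  assert (HJ : 0 <= J) by (unfold J; nra).
  (* Three consecutive samples span [2 * s] indices, and each sample gains at least 1, whence the
     slope [/ INR s]. [J] bounds the distance to the preceding sample: it is paid once for the final
     point, and twice in the product, for [p n] and for [p k]. *)
  exists (2 * s)%nat, (INR s), (1 + J), (a + 2 * delta + 2 * J).
  split; [lia|]. split; [lra|]. split; [lra|]. split; [lra|].
  intros n p Hqg.
  set (x := fun i => p (i * s)%nat). set (q := (n / s)%nat).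
  assert (Eq : (q * s <= n)%nat /\ (n - q * s <= s)%nat) by
    (pose proof (Nat.div_mod_eq n s); pose proof (Nat.mod_upper_bound n s ltac:(lia)); unfold q; nia).
  assert (Hlong : forall i, (i < q)%nat -> dist (x i) (x (S i)) >= / K * INR s - C) by
    (intros i Hi; unfold x; pose proof (Nat.mul_le_mono_r (S i) q s Hi);
     pose proof (Hqg (i * s)%nat (S i * s)%nat ltac:(lia) ltac:(lia) ltac:(lia)) as G;
     replace (S i * s - i * s)%nat with s in G by lia; lra).
  assert (Hturn : forall i, (S i < q)%nat -> gp Y (x i) (x (S (S i))) (x (S i)) <= a).
  { intros i Hi. unfold x. pose proof (Nat.mul_le_mono_r (S (S i)) q s Hi).
    assert (Hpow : (2 * s <= 2 ^ S j)%nat) by reflexivity.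
    assert (Hin : (i * s + 2 * s <= n)%nat) by lia.
    pose proof (quasi_geodesic_log_morse K C (S j) (2 * s) (fun t => p (i * s + t)%nat) s HK HC Hpow
      (local_qg_shift _ _ _ _ _ (i * s) (2 * s) Hin Hqg) ltac:(lia)) as G.
    cbv beta in G. rewrite Nat.add_0_r in G.
    replace (S i * s)%nat with (i * s + s)%nat by lia.
    replace (S (S i) * s)%nat with (i * s + 2 * s)%nat by lia. exact G. }
  assert (Hend : dist (x q) (p n) <= J) by
    (unfold x; pose proof (Hqg (q * s)%nat n ltac:(lia) ltac:(lia) ltac:(lia)) as G;
     assert (INR (n - q * s) <= INR s) by (apply le_INR; lia); unfold J; nra).
  split.
  - pose proof (broken_dist x q a _ Hell Hlong Hturn Ha q (le_n _)) as B.
    pose proof (dist_tri Y (x 0%nat) (p n) (x q)) as T.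
    rewrite (dist_sym Y (p n)) in T. change (x 0%nat) with (p 0%nat) in *.
    assert (/ INR s * INR n <= INR q + 1).
    { apply Rmult_le_reg_l with (INR s); [lra|]. rewrite <- Rmult_assoc, Rinv_r, Rmult_1_l by lra.
      rewrite <- S_INR, <- mult_INR. apply le_INR. nia. }
    lra.
  - intros k Hk. set (i := (k / s)%nat).
    assert (Ei : (i * s <= k)%nat /\ (k - i * s <= s)%nat) by
      (pose proof (Nat.div_mod_eq k s); pose proof (Nat.mod_upper_bound k s ltac:(lia)); unfold i; nia).
    assert (Hiq : (i <= q)%nat) by (apply Nat.Div0.div_le_mono; lia).
    pose proof (broken_middle x q a _ i Ha Hell Hlong Hturn Hiq) as B.
    assert (Hki : dist (p k) (x i) <= J).
    { rewrite dist_sym. unfold x. pose proof (Hqg (i * s)%nat k ltac:(lia) ltac:(lia) ltac:(lia)) as G.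
      assert (INR (k - i * s) <= INR s) by (apply le_INR; lia). unfold J; nra. }
    pose proof (gp_move_base (p 0%nat) (p n) (p k) (x i)) as G1.
    pose proof (gp_move_r (p 0%nat) (p n) (x q) (x i)) as G2.
    rewrite (dist_sym Y (p n)) in G2. change (x 0%nat) with (p 0%nat) in *. lra.
Qed.

(** For quasi-geodesics the logarithmic loss of [gp_path_far] becomes a constant. Some [p k] behaves
    like a projection of [w]: the products of [w] with either end at [p k] are bounded, so the
    product of the ends at [w] is at least [dist w (p k)] up to a constant. *)
Lemma quasi_geodesic_far K C :
  1 <= K -> 0 <= C -> exists D, forall n p w r, local_qg n n K C p ->
    (forall i, (i <= n)%nat -> r <= dist w (p i)) ->
    r - D <= gp Y (p 0%nat) (p n) w.
Proof.
  intros HK HC.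
  destruct (local_to_global K C HK HC) as (L & K' & C' & D & HL & HK' & HC' & HD & HG).
  destruct Hyp as [Hd H4].
  exists (2 * (D + delta + (K + C))). intros n p w r Hp Hr.
  assert (Hgp : forall k, (k <= n)%nat -> gp Y (p 0%nat) (p n) (p k) <= D).
  { apply HG. intros i j Hi Hj Hij. apply Hp; lia. }
  set (E := D + delta).
  (* The first product is 0 at the start. Where it first exceeds [E], the hyperbolic inequality
     bounds the second by [E]; going back one step costs [K + C]. If it never exceeds [E], the
     endpoint works. *)
  assert (Hk : exists k, (k <= n)%nat /\ gp Y (p 0%nat) w (p k) <= E + (K + C) /\ gp Y (p n) w (p k) <= E + (K + C)).
  { destruct (classic (gp Y (p 0%nat) w (p n) <= E)) as [HP|HP].
    - exists n. rewrite (gp_base_l (p n)). unfold E in *. repeat split; auto; lra.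
    - destruct (first_exit (fun k => gp Y (p 0%nat) w (p k) <= E) n) as (t & Ht & A1 & A2); auto.
      { rewrite gp_base_l. unfold E; lra. }
      exists t. split; [lia|]. split; [lra|].
      pose proof (H4 (p 0%nat) w (p n) (p (S t))) as A3. specialize (Hgp (S t) ltac:(lia)).
      pose proof (gp_move_base (p n) w (p t) (p (S t))) as A4.
      destruct (Hp t (S t) ltac:(lia) ltac:(lia) ltac:(lia)) as [_ A5].
      replace (S t - t)%nat with 1%nat in A5 by lia. simpl in A5.
      rewrite (gp_sym w (p n)) in A3. unfold E in *.
      unfold Rmin in A3. destruct Rle_dec in A3; lra. }
  destruct Hk as (k & Hkn & B1 & B2). specialize (Hr k Hkn).
  pose proof (dist_tri Y (p 0%nat) (p k) (p n)) as T.
  unfold gp, E in *. rewrite (dist_sym Y (p k) (p n)) in T. rewrite (dist_sym Y w (p k)) in *. lra.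
Qed.

Theorem local_to_global_Z K C :
  1 <= K -> 0 <= C ->
  exists (L : Z) (K' C' D : R), (1 <= L)%Z /\ 1 <= K' /\ 0 <= C' /\ 0 <= D /\
    forall p : Z -> Y,
      (forall m n, (m <= n <= m + L)%Z ->
        / K * IZR (n - m) - C <= dist (p m) (p n) <= K * IZR (n - m) + C) ->
      (forall m n, (m <= n)%Z -> / K' * IZR (n - m) - C' <= dist (p m) (p n)) /\
      (forall m k n, (m <= k <= n)%Z -> gp Y (p m) (p n) (p k) <= D).
Proof.
  intros HK HC.
  destruct (local_to_global K C HK HC) as (L & K' & C' & D & HL & HK' & HC' & HD & HG).
  exists (Z.of_nat L), K', C', D. split; [lia|]. do 3 (split; [assumption|]).
  intros p H.
  assert (Hq : forall m n, local_qg L n K C (fun i => p (m + Z.of_nat i)%Z)) by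
    (intros m' n' i j Hij Hj HL'; rewrite INR_IZR_INZ;
     replace (Z.of_nat (j - i)) with ((m' + Z.of_nat j) - (m' + Z.of_nat i))%Z by lia;
     apply H; lia).
  split.
  - intros m n Hmn. destruct (HG (Z.to_nat (n - m)) _ (Hq m _)) as [G _].
    rewrite INR_IZR_INZ, Z2Nat.id in G by lia.
    replace (m + Z.of_nat 0)%Z with m in G by lia.
    replace (m + (n - m))%Z with n in G by lia. exact G.
  - intros m k n Hmn. destruct (HG (Z.to_nat (n - m)) _ (Hq m _)) as [_ G].
    specialize (G (Z.to_nat (k - m)) ltac:(lia)). rewrite !Z2Nat.id in G by lia.
    replace (m + Z.of_nat 0)%Z with m in G by lia.
    replace (m + (n - m))%Z with n in G by lia.
    replace (m + (k - m))%Z with k in G by lia. exact G.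
Qed.

End HyperbolicSpace.

(** * Groups and word metrics *)

Section GroupFacts.
Variable G : Grp.
Implicit Types g h x y : G.

Lemma gmul_inv_l_cancel g x : gmul (ginv g) (gmul g x) = x.
Proof. rewrite gassoc, ginv_l. apply gone_l. Qed.

Lemma gmul_inv_r_cancel g x : gmul g (gmul (ginv g) x) = x.
Proof. rewrite gassoc, ginv_r. apply gone_l. Qed.

Lemma ginv_unique g h : gmul g h = gone -> h = ginv g.
Proof. intros E. rewrite <- (gmul_inv_l_cancel g h), E. apply gone_r. Qed.

Lemma ginv_involutive g : ginv (ginv g) = g.
Proof. symmetry. apply ginv_unique, ginv_l. Qed.

Lemma ginv_mul g h : ginv (gmul g h) = gmul (ginv h) (ginv g).
Proof.
  symmetry. apply ginv_unique.
  rewrite <- (gassoc _ g h), gmul_inv_r_cancel. apply ginv_r.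
Qed.

Lemma ginv_one : ginv (@gone G) = gone.
Proof. symmetry. apply ginv_unique, gone_l. Qed.

Lemma hom_one f : is_hom G f -> f gone = gone.
Proof.
  intros Hf. rewrite <- (gmul_inv_l_cancel (f gone) (f gone)), <- Hf, gone_l. apply ginv_l.
Qed.

Lemma hom_inv f g : is_hom G f -> f (ginv g) = ginv (f g).
Proof.
  intros Hf. apply ginv_unique. rewrite <- Hf, ginv_r. apply hom_one, Hf.
Qed.

Lemma hom_pow f g n : is_hom G f -> f (gpow G g n) = gpow G (f g) n.
Proof.
  intros Hf. induction n as [|n IH]; simpl; [apply hom_one, Hf|]. rewrite Hf, IH. reflexivity.
Qed.

Lemma aut_infinite_order f a : is_aut G f -> infinite_order G a -> infinite_order G (f a).
Proof.
  intros (Hh & Hi & _) Ha n Hn E. apply (Ha n Hn), Hi.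
  rewrite hom_pow, E, hom_one; auto.
Qed.

Lemma aut_inverse f : is_aut G f ->
  exists f', is_aut G f' /\ (forall x, f (f' x) = x) /\ (forall x, f' (f x) = x).
Proof.
  intros (Hh & Hi & Hs). destruct (choice (fun y x => f x = y) Hs) as [f' Hf'].
  exists f'. split; [split; [|split]|split; auto].
  - intros x y. apply Hi. rewrite Hh, !Hf'. reflexivity.
  - intros x y E. rewrite <- (Hf' x), <- (Hf' y), E. reflexivity.
  - intros y. exists (f y). apply Hi, Hf'.
Qed.

Lemma out_eq_sym f f' : out_eq G f f' -> out_eq G f' f.
Proof.
  intros [h Hh]. exists (ginv h). intros x.
  rewrite Hh, ginv_involutive, <- !gassoc, ginv_l, gone_r, gmul_inv_l_cancel. reflexivity.
Qed.

Definition zpow (b : G) (z : Z) : G :=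
  if (0 <=? z)%Z then gpow G b (Z.to_nat z) else ginv (gpow G b (Z.to_nat (- z))).

Lemma gpow_comm (b : G) n : gmul b (gpow G b n) = gmul (gpow G b n) b.
Proof.
  induction n as [|n IH]; simpl; [rewrite gone_l, gone_r; reflexivity|].
  rewrite IH at 1. rewrite gassoc. reflexivity.
Qed.

Lemma zpow_succ (b : G) z : zpow b (z + 1) = gmul b (zpow b z).
Proof.
  unfold zpow. destruct (Z.leb_spec 0 z), (Z.leb_spec 0 (z + 1)); try lia.
  - replace (Z.to_nat (z + 1)) with (S (Z.to_nat z)) by lia. reflexivity.
  - replace (Z.to_nat (z + 1)) with 0%nat by lia. replace (Z.to_nat (- z)) with 1%nat by lia.
    simpl. rewrite gone_r, ginv_r. reflexivity.
  - replace (Z.to_nat (- z)) with (S (Z.to_nat (- (z + 1)))) by lia. simpl.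
    rewrite gpow_comm, ginv_mul, gmul_inv_r_cancel. reflexivity.
Qed.

Lemma gpow_mult_one (b : G) n k : gpow G b n = gone -> gpow G b (n * k) = gone.
Proof.
  assert (Add : forall i j, gpow G b (i + j) = gmul (gpow G b i) (gpow G b j)).
  { induction i as [|i IH]; intros j; simpl; [rewrite gone_l; reflexivity|].
    rewrite IH, gassoc. reflexivity. }
  intros E. induction k as [|k IH]; [rewrite Nat.mul_0_r; reflexivity|].
  rewrite Nat.mul_succ_r, Add, IH, E. apply gone_l.
Qed.

End GroupFacts.

(** * The word metric and the vertex set of the Cayley graph *)

Section Cayley.
Variables (Gam : Grp) (Sg : list Gam).
Hypothesis Gen : generates Gam Sg.

Notation wl := (wlen Gam Sg).
Notation d := (dS Gam Sg).

(** [wlen] is an [epsilon] term, so its defining property holds once a least length exists;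
    generation makes the set of lengths nonempty. *)
Lemma wlen_spec g : wl_le Gam Sg g (wl g) /\ forall m, wl_le Gam Sg g m -> (wl g <= m)%nat.
Proof.
  unfold wlen. apply epsilon_spec.
  assert (E : exists n, wl_le Gam Sg g n).
  { destruct (Gen g) as (w & Hw & E). exists (length w), w. auto. }
  destruct (dec_inh_nat_subset_has_unique_least_element _ (fun n => classic (wl_le Gam Sg g n)) E)
    as (n & Hn & _).
  exists n. exact Hn.
Qed.

Lemma wlen_word g : exists w, word_over Gam Sg w /\ wprod Gam w = g /\ length w = wl g.
Proof.
  destruct (wlen_spec g) as [(w & Hw & E & L) Hm]. exists w. split; [|split]; auto.
  specialize (Hm (length w) ltac:(exists w; auto)). lia.
Qed.

Lemma wlen_wprod w : word_over Gam Sg w -> (wl (wprod Gam w) <= length w)%nat.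
Proof. intros Hw. apply wlen_spec. exists w. auto. Qed.

Lemma wprod_app w w' : wprod Gam (w ++ w') = gmul (wprod Gam w) (wprod Gam w').
Proof.
  induction w as [|[b s] w IH]; simpl; [rewrite gone_l; reflexivity|].
  rewrite IH, gassoc. reflexivity.
Qed.

Lemma wlen_one : wl gone = 0%nat.
Proof. pose proof (wlen_wprod nil) as H. simpl in H. specialize (H ltac:(intros p [])). lia. Qed.

Lemma wlen_zero g : wl g = 0%nat -> g = gone.
Proof.
  intros H. destruct (wlen_word g) as ([|p w] & _ & E & L); [symmetry; exact E|simpl in L; lia].
Qed.

Lemma wlen_mul g h : (wl (gmul g h) <= wl g + wl h)%nat.
Proof.
  destruct (wlen_word g) as (w & Hw & E & L). destruct (wlen_word h) as (w' & Hw' & E' & L').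
  rewrite <- L, <- L', <- length_app, <- E, <- E', <- wprod_app. apply wlen_wprod.
  intros p Hp. apply in_app_or in Hp. destruct Hp; auto.
Qed.

Lemma wlen_inv_le g : (wl (ginv g) <= wl g)%nat.
Proof.
  destruct (wlen_word g) as (w & Hw & E & L). rewrite <- L, <- E. clear g E L.
  induction w as [|[b s] w IH]; simpl.
  - rewrite ginv_one, wlen_one. lia.
  - rewrite ginv_mul. pose proof (wlen_mul (ginv (wprod Gam w)) (ginv (letter Gam b s))).
    assert (wl (ginv (letter Gam b s)) <= 1)%nat.
    { replace (ginv (letter Gam b s)) with (wprod Gam ((negb b, s) :: nil)).
      - apply wlen_wprod. intros p [<-|[]]. apply (Hw (b, s)). left. reflexivity.
      - simpl. rewrite gone_r. destruct b; simpl; [|rewrite ginv_involutive]; reflexivity. }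
    specialize (IH ltac:(intros p Hp; apply Hw; right; exact Hp)). lia.
Qed.

Lemma wlen_inv g : wl (ginv g) = wl g.
Proof.
  pose proof (wlen_inv_le g). pose proof (wlen_inv_le (ginv g)). rewrite ginv_involutive in *. lia.
Qed.

Lemma wlen_gen s : In s Sg -> (wl s <= 1)%nat.
Proof.
  intros Hs. replace s with (wprod Gam ((true, s) :: nil)).
  - apply wlen_wprod. intros p [<-|[]]. exact Hs.
  - simpl. apply gone_r.
Qed.

Lemma dS_refl g : d g g = 0.
Proof. unfold dS. rewrite ginv_l, wlen_one. reflexivity. Qed.

Lemma dS_eq0 g h : d g h = 0 -> g = h.
Proof.
  unfold dS. intros H. apply (INR_eq _ 0), wlen_zero in H.
  rewrite <- (gmul_inv_r_cancel _ g h), H, gone_r. reflexivity.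
Qed.

Lemma dS_sym g h : d g h = d h g.
Proof.
  unfold dS. rewrite <- wlen_inv, ginv_mul, ginv_involutive. reflexivity.
Qed.

Lemma dS_tri g h k : d g k <= d g h + d h k.
Proof.
  unfold dS. rewrite <- plus_INR. apply le_INR.
  replace (gmul (ginv g) k) with (gmul (gmul (ginv g) h) (gmul (ginv h) k)).
  - apply wlen_mul.
  - rewrite <- gassoc, gmul_inv_r_cancel. reflexivity.
Qed.

Lemma dS_nonneg g h : 0 <= d g h.
Proof. apply pos_INR. Qed.

Lemma dS_left g h k : d (gmul g h) (gmul g k) = d h k.
Proof. unfold dS. rewrite ginv_mul, <- gassoc, gmul_inv_l_cancel. reflexivity. Qed.

(** Only vertices are points. Its [gp] is convertible to [gpS], so results on [MSpace] transfer by
    [change]. *)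
Definition cayley : MSpace :=
  {| pt := Gam; dist := d; dist_refl := dS_refl; dist_eq0 := dS_eq0;
     dist_sym := dS_sym; dist_tri := dS_tri |}.

Lemma cayley_hyperbolic : hyperbolic_group Gam Sg -> gromov_hyperbolic cayley.
Proof. intros H. exact H. Qed.

(** Every subpath is at most as long as its number of steps; since the total is attained, all these
    inequalities are equalities. *)
Lemma unit_steps_geodesic (q : nat -> Gam) N :
  (forall i, (i < N)%nat -> d (q i) (q (S i)) <= 1) ->
  INR N <= d (q 0%nat) (q N) ->
  forall i j, (i <= j)%nat -> (j <= N)%nat -> d (q i) (q j) = INR (j - i).
Proof.
  intros Hs HN.
  assert (Le : forall k i, (i + k <= N)%nat -> d (q i) (q (i + k)%nat) <= INR k).
  { induction k as [|k IH]; intros i Hi.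
    - rewrite Nat.add_0_r, dS_refl. simpl. lra.
    - rewrite Nat.add_succ_r, S_INR. specialize (IH i ltac:(lia)).
      specialize (Hs (i + k)%nat ltac:(lia)).
      pose proof (dS_tri (q i) (q (i + k)%nat) (q (S (i + k)))). lra. }
  intros i j Hij Hj.
  pose proof (Le (j - i)%nat i ltac:(lia)) as A. replace (i + (j - i))%nat with j in A by lia.
  pose proof (Le i 0%nat ltac:(lia)) as B. simpl in B.
  pose proof (Le (N - j)%nat j ltac:(lia)) as C. replace (j + (N - j))%nat with N in C by lia.
  pose proof (dS_tri (q 0%nat) (q i) (q N)). pose proof (dS_tri (q i) (q j) (q N)).
  rewrite minus_INR in * by lia. lra.
Qed.

Lemma firstn_S_nth (T : Type) (t0 : T) (w : list T) i :
  (i < length w)%nat -> firstn (S i) w = firstn i w ++ nth i w t0 :: nil.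
Proof.
  revert w. induction i as [|i IH]; intros [|t w] H; simpl in *; try lia; auto.
  f_equal. apply IH. lia.
Qed.

(** The geodesic reads the prefixes of a shortest word for [g^-1 h], translated by [g]. *)
Lemma cayley_geodesic g h : exists (N : nat) (q : nat -> Gam),
  d g h = INR N /\ q 0%nat = g /\ q N = h /\
  forall i j, (i <= j)%nat -> (j <= N)%nat -> d (q i) (q j) = INR (j - i).
Proof.
  destruct (wlen_word (gmul (ginv g) h)) as (w & Hw & E & L).
  exists (wl (gmul (ginv g) h)), (fun i => gmul g (wprod Gam (firstn i w))).
  assert (EN : gmul g (wprod Gam (firstn (wl (gmul (ginv g) h)) w)) = h).
  { rewrite <- L, firstn_all, E. apply gmul_inv_r_cancel. }
  split; [reflexivity|]. split; [simpl; apply gone_r|]. split; [exact EN|].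
  apply unit_steps_geodesic; [|rewrite EN; simpl; rewrite gone_r; apply Rle_refl].
  intros i Hi. rewrite dS_left, (firstn_S_nth _ (true, gone)), wprod_app by lia.
  rewrite <- (gone_r _ (wprod Gam (firstn i w))) at 1. rewrite dS_left.
  unfold dS. rewrite ginv_one, gone_l. apply (le_INR _ 1).
  apply wlen_wprod. intros p [<-|[]]. apply Hw, nth_In. lia.
Qed.

Lemma cayley_chain_geodesic : chain_geodesic cayley.
Proof.
  intros g h. destruct (cayley_geodesic g h) as (N & q & E & q0 & qN & Hq).
  exists N, q. split; [exact q0|]. split; [exact qN|]. split; intros i Hi; simpl.
  - rewrite Hq by lia. replace (S i - i)%nat with 1%nat by lia. simpl. lra.
  - rewrite <- q0, <- qN, !Hq by lia. rewrite <- plus_INR. f_equal. lia.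
Qed.

Lemma ball_finite n : exists l : list Gam, forall g, (wl g <= n)%nat -> In g l.
Proof.
  induction n as [|n (l & Hl)].
  - exists (gone :: nil). intros g Hg. left. symmetry. apply wlen_zero. lia.
  - exists (l ++ flat_map (fun s => map (gmul s) l ++ map (gmul (ginv s)) l) Sg).
    intros g Hg. apply in_or_app.
    destruct (wlen_word g) as ([|[b s] w] & Hw & E & L).
    + left. apply Hl. simpl in L. lia.
    + right. apply in_flat_map. exists s. split; [apply (Hw (b, s)); left; reflexivity|].
      assert (In (wprod Gam w) l).
      { apply Hl. pose proof (wlen_wprod w ltac:(intros p Hp; apply Hw; right; exact Hp)).
        simpl in L. lia. }
      rewrite <- E. simpl. apply in_or_app. destruct b; [left|right]; simpl; apply in_map; auto.
Qed.

Lemma ball_finite_at (c : Gam) (r : R) : exists l : list Gam, forall g, d c g <= r -> In g l.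
Proof.
  destruct (INR_unbounded r) as [n Hn]. destruct (ball_finite n) as [l Hl].
  exists (map (gmul c) l). intros g Hg. rewrite <- (gmul_inv_r_cancel _ c g).
  apply in_map, Hl. apply INR_le. unfold dS in Hg. lra.
Qed.

(** Induction along a shortest word. It serves both the word length of images under a homomorphism
    and the displacement of a point under a representation. *)
Lemma lipschitz_of_gens (f : Gam -> R) M :
  0 <= M -> f gone <= 0 ->
  (forall b s g, In s Sg -> f (gmul (letter Gam b s) g) <= M + f g) ->
  forall g, f g <= M * INR (wl g).
Proof.
  intros HM H1 Hs g. destruct (wlen_word g) as (w & Hw & E & L). rewrite <- L, <- E. clear g E L.
  induction w as [|[b s] w IH]; [simpl; lra|].
  specialize (IH ltac:(intros p Hp; apply Hw; right; exact Hp)).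
  specialize (Hs b s (wprod Gam w) (Hw (b, s) ltac:(left; reflexivity))).
  simpl length. rewrite S_INR. simpl wprod. lra.
Qed.

Lemma list_bound (T : Type) (f : T -> R) (l : list T) : exists M, 1 <= M /\ forall t, In t l -> f t <= M.
Proof.
  induction l as [|t l (M & H1 & HM)]; [exists 1; split; [lra|intros t []]|].
  exists (Rmax M (f t)). pose proof (Rmax_l M (f t)). pose proof (Rmax_r M (f t)).
  split; [lra|]. intros u [<-|Hu]; auto. specialize (HM u Hu). lra.
Qed.

Lemma hom_lipschitz f : is_hom Gam f ->
  exists K, 1 <= K /\ forall g h, d (f g) (f h) <= K * d g h.
Proof.
  intros Hf. destruct (list_bound _ (fun s => INR (wl (f s))) Sg) as (M & H1 & HM).
  exists M. split; auto. intros g h. unfold dS. rewrite <- hom_inv, <- Hf by auto.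
  apply (lipschitz_of_gens (fun x => INR (wl (f x)))); [lra| |].
  - rewrite hom_one, wlen_one by auto. simpl. lra.
  - intros b s x Hs. rewrite Hf. specialize (HM s Hs).
    pose proof (wlen_mul (f (letter Gam b s)) (f x)) as H. apply le_INR in H. rewrite plus_INR in H.
    assert (wl (f (letter Gam b s)) = wl (f s)) as E
      by (destruct b; simpl; [|rewrite hom_inv, wlen_inv by auto]; reflexivity).
    rewrite E in H. lra.
Qed.

End Cayley.

(** * Compactness by diagonal extraction *)

Lemma pigeonhole_infinite {T : Type} (P : nat -> Prop) (f : nat -> T) (l : list T) :
  (forall N, exists n, (N <= n)%nat /\ P n) -> (forall n, In (f n) l) ->
  exists v, forall N, exists n, (N <= n)%nat /\ P n /\ f n = v.
Proof.
  intros HP Hf. apply NNPP. intros Hno.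
  assert (Hb : forall v, exists N, forall n, (N <= n)%nat -> P n -> f n <> v).
  { intros v. apply NNPP. intros Hv. apply Hno. exists v. intros N. apply NNPP. intros HN.
    apply Hv. exists N. intros n Hn Hpn E. apply HN. exists n. auto. }
  assert (HB : exists N, forall n, (N <= n)%nat -> P n -> ~ In (f n) l).
  { clear Hf. induction l as [|v l (N & IH)]; [exists 0%nat; intros n _ _ []|].
    destruct (Hb v) as [N' HN']. exists (max N N'). intros n Hn Hpn [E|E].
    - apply (HN' n); auto; lia.
    - apply (IH n); auto; lia. }
  destruct HB as [N HN]. destruct (HP N) as (n & Hn & Hpn). apply (HN n Hn Hpn), Hf.
Qed.

(** Initial segments shared by infinitely many of the sequences are extended one term at a time by
    the pigeonhole principle. The limit is described by agreement with arbitrarily late [f n] on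
    each initial segment, in place of an explicit subsequence. *)
Lemma konig {T : Type} (f : nat -> nat -> T) (B : nat -> list T) :
  (forall n t, In (f n t) (B t)) ->
  exists l : nat -> T, forall k N, exists n, (N <= n)%nat /\ forall t, (t < k)%nat -> f n t = l t.
Proof.
  intros Hf.
  set (good := fun (k : nat) (g : nat -> T) =>
    forall N, exists n, (N <= n)%nat /\ forall t, (t < k)%nat -> f n t = g t).
  (* The implication sits under the existential so that choice yields a total extension function. *)
  assert (step : forall k g, exists g', good k g -> good (S k) g' /\ forall t, (t < k)%nat -> g' t = g t).
  { intros k g. destruct (classic (good k g)) as [Hg|Hg]; [|exists g; contradiction].
    destruct (pigeonhole_infinite _ (fun n => f n k) (B k) Hg (fun n => Hf n k)) as [v Hv].
    exists (fun t => if Nat.eq_dec t k then v else g t). intros _. split.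
    - intros N. destruct (Hv N) as (n & Hn & Ha & E). exists n. split; auto.
      intros t Ht. destruct (Nat.eq_dec t k) as [->|Hne]; auto. apply Ha. lia.
    - intros t Ht. destruct (Nat.eq_dec t k); [lia|reflexivity]. }
  destruct (choice (fun (a : nat * (nat -> T)) g' =>
    good (fst a) (snd a) -> good (S (fst a)) g' /\ forall t, (t < fst a)%nat -> g' t = snd a t)) as [nx Hnx].
  { intros [k g]. apply step. }
  set (G := fix G k := match k with O => f 0%nat | S k => nx (k, G k) end).
  assert (HG : forall k, good k (G k)).
  { induction k as [|k IH].
    - intros N. exists N. split; [lia|]. intros t Ht. lia.
    - apply (Hnx (k, G k)), IH. }
  assert (Hstab : forall k t, (t < k)%nat -> G k t = G (S t) t).
  { induction k as [|k IH]; intros t Ht; [lia|].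
    destruct (Nat.eq_dec t k) as [->|Hne]; [reflexivity|].
    rewrite <- (IH t) by lia. apply (Hnx (k, G k) (HG k)). simpl. lia. }
  exists (fun t => G (S t) t). intros k N. destruct (HG k N) as (n & Hn & Ha).
  exists n. split; auto. intros t Ht. rewrite Ha, Hstab by auto. reflexivity.
Qed.

(** * Limits of geodesic segments in a Cayley graph *)

Section CayleyHyperbolic.
Variables (Gam : Grp) (Sg : list Gam).
Hypothesis Gen : generates Gam Sg.
Variable delta : R.
Hypothesis Hyp : hyp_with (cayley Gam Sg Gen) delta.

Notation d := (dS Gam Sg).
Notation gpr := (gpS Gam Sg).
Let sym := dS_sym Gam Sg Gen.
Let tri := dS_tri Gam Sg Gen.

Lemma nat_floor (r : R) : 0 <= r -> exists i : nat, INR i <= r < INR i + 1.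
Proof.
  intros Hr. destruct (archimed r) as [A B].
  assert (0 < up r)%Z by (apply lt_IZR; lra).
  exists (Z.to_nat (up r - 1)). rewrite INR_IZR_INZ, Z2Nat.id by lia. rewrite minus_IZR. lra.
Qed.

(** The foot of [z] lies at distance [(q N | z)] from [q 0], where both terms of the maximum in
    [four_point] agree; rounding down to a vertex costs at most 1. *)
Lemma near_geodesic N (q : nat -> Gam) z :
  (forall i j, (i <= j)%nat -> (j <= N)%nat -> d (q i) (q j) = INR (j - i)) ->
  exists i, (i <= N)%nat /\ d z (q i) <= gpr (q 0%nat) (q N) z + 2 * delta + 1.
Proof.
  intros Hq.
  pose proof (gp_nonneg (cayley Gam Sg Gen) (q N) z (q 0%nat)) as P1.
  pose proof (gp_nonneg (cayley Gam Sg Gen) (q 0%nat) z (q N)) as P2.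
  destruct (nat_floor _ P1) as [i [Hi1 Hi2]].
  pose proof (Hq 0%nat N ltac:(lia) ltac:(lia)) as EN. rewrite Nat.sub_0_r in EN.
  unfold gp in *. simpl in *. rewrite (sym (q N) (q 0%nat)), (sym z (q 0%nat)), (sym z (q N)) in *.
  assert (HiN : (i <= N)%nat) by (apply INR_le; lra).
  exists i. split; [exact HiN|].
  pose proof (Hq 0%nat i ltac:(lia) ltac:(lia)) as E1. rewrite Nat.sub_0_r in E1.
  pose proof (Hq i N ltac:(lia) ltac:(lia)) as E2. rewrite minus_INR in E2 by lia.
  pose proof (four_point (cayley Gam Sg Gen) delta Hyp z (q 0%nat) (q i) (q N)) as F. simpl in F.
  unfold gpS. rewrite (sym z (q 0%nat)), (sym z (q N)) in F.
  unfold Rmax in F. destruct Rle_dec in F; lra.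
Qed.

(* [r] is constant outside [[-a, b]], where only the Lipschitz bound remains. *)
Lemma centered_segment (x y z : Gam) : exists (a b : Z) (r : Z -> Gam),
  (0 <= a)%Z /\ (0 <= b)%Z /\ r (- a)%Z = x /\ r b = y /\
  (forall s t, d (r s) (r t) <= IZR (Z.abs (s - t))) /\
  (forall s t, (- a <= s <= b)%Z -> (- a <= t <= b)%Z -> d (r s) (r t) = IZR (Z.abs (s - t))) /\
  d z (r 0%Z) <= gpr x y z + 2 * delta + 1 /\
  (forall z', exists t, (- a <= t <= b)%Z /\ d z' (r t) <= gpr x y z' + 2 * delta + 1).
Proof.
  destruct (cayley_geodesic Gam Sg Gen x y) as (N & q & _ & q0 & qN & Hq).
  assert (Near := fun z' => near_geodesic N q z' Hq).
  destruct (Near z) as (i & Hi & Hz). rewrite q0, qN in *.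
  (* Parameter 0 is placed at the index [i] of the foot of [z], and indices are clamped to the
     segment. *)
  set (cl := fun t => Z.max 0 (Z.min (Z.of_nat N) (Z.of_nat i + t))).
  set (r := fun t => q (Z.to_nat (cl t))).
  assert (Hr : forall s t, d (r s) (r t) = IZR (Z.abs (cl s - cl t))).
  { assert (W : forall s t, (cl s <= cl t)%Z -> d (r s) (r t) = IZR (Z.abs (cl s - cl t))).
    { intros s t Hst. unfold r. rewrite Hq by (unfold cl in *; lia).
      rewrite INR_IZR_INZ. f_equal. unfold cl in *. lia. }
    intros s t. destruct (Z.le_ge_cases (cl s) (cl t)); auto.
    rewrite sym, W by auto. f_equal. lia. }
  exists (Z.of_nat i), (Z.of_nat N - Z.of_nat i)%Z, r.
  split; [lia|]. split; [lia|].
  split; [unfold r; rewrite <- q0; f_equal; unfold cl; lia|].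
  split; [unfold r; rewrite <- qN; f_equal; unfold cl; lia|].
  split; [intros s t; rewrite Hr; apply IZR_le; unfold cl; lia|].
  split; [intros s t Hs Ht; rewrite Hr; f_equal; unfold cl; lia|].
  split; [unfold r; replace (Z.to_nat (cl 0%Z)) with i by (unfold cl; lia); exact Hz|].
  intros z'. destruct (Near z') as (j & Hj & Hz').
  exists (Z.of_nat j - Z.of_nat i)%Z. split; [lia|]. unfold r.
  replace (Z.to_nat (cl (Z.of_nat j - Z.of_nat i)%Z)) with j by (unfold cl; lia). exact Hz'.
Qed.

Lemma same_end_intro (u v : nat -> Gam) (c : Gam) :
  (forall M, exists N, forall n m, (N <= n)%nat -> (N <= m)%nat -> gpr (u n) (v m) c >= M) ->
  same_end Gam Sg u v.
Proof.
  intros H M. destruct (H (M + d c gone)) as [N HN]. exists N. intros n m Hn Hm.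
  specialize (HN n m Hn Hm).
  pose proof (gp_move_base (cayley Gam Sg Gen) (u n) (v m) c gone) as G.
  change (gp (cayley Gam Sg Gen)) with gpr in G. change (@dist (cayley Gam Sg Gen)) with d in G. lra.
Qed.

Lemma same_end_move_r (u v v' : nat -> Gam) c :
  (forall n, d (v n) (v' n) <= c) -> same_end Gam Sg u v -> same_end Gam Sg u v'.
Proof.
  intros Hc H M. destruct (H (M + c)) as [N HN]. exists N. intros n m Hn Hm.
  specialize (HN n m Hn Hm). specialize (Hc m).
  pose proof (gp_move_r (cayley Gam Sg Gen) (u n) (v m) (v' m) gone) as G.
  change (gp (cayley Gam Sg Gen)) with gpr in G. change (@dist (cayley Gam Sg Gen)) with d in G. lra.
Qed.

Lemma same_end_subseq_r (u v : nat -> Gam) (f : nat -> nat) :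
  (forall n, (n <= f n)%nat) -> same_end Gam Sg u v -> same_end Gam Sg u (fun n => v (f n)).
Proof.
  intros Hf H M. destruct (H M) as [N HN]. exists N. intros n m Hn Hm.
  apply HN; auto. specialize (Hf m). lia.
Qed.

Lemma same_end_trans (u v w : nat -> Gam) :
  same_end Gam Sg u v -> same_end Gam Sg v w -> same_end Gam Sg u w.
Proof.
  intros H1 H2 M. destruct (H1 (M + delta)) as [N1 HN1]. destruct (H2 (M + delta)) as [N2 HN2].
  exists (max N1 N2). intros n m Hn Hm.
  specialize (HN1 n (max N1 N2) ltac:(lia) ltac:(lia)).
  specialize (HN2 (max N1 N2) m ltac:(lia) ltac:(lia)).
  pose proof (proj2 Hyp (u n) (v (max N1 N2)) (w m) gone) as G.
  change (gp (cayley Gam Sg Gen)) with gpr in G.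
  unfold Rmin in G. destruct Rle_dec in G; lra.
Qed.

(** The sign [sg] treats both ends at once. Two points of [l] on the same side of [l 0] have product
    equal to the smaller of their distances to [l 0]; replacing one by a point of [p] costs at most
    [D]. *)
Lemma same_end_of_near (l p : Z -> Gam) (sg : Z) D :
  (sg = 1 \/ sg = -1)%Z ->
  (forall m n, d (l m) (l n) = IZR (Z.abs (m - n))) ->
  (forall M, exists N, forall n, (N <= n)%nat ->
     exists t, M <= IZR (sg * t) /\ d (p (sg * Z.of_nat n)%Z) (l t) <= D) ->
  same_end Gam Sg (fun n => l (sg * Z.of_nat n)%Z) (fun n => p (sg * Z.of_nat n)%Z).
Proof.
  intros Hsg Hl Hp. apply same_end_intro with (l 0%Z). intros M.
  destruct (INR_unbounded (Rmax 0 M + D)) as [N1 HN1].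
  destruct (Hp (INR N1)) as [N2 HN2].
  exists (max N1 N2). intros n m Hn Hm.
  destruct (HN2 m ltac:(lia)) as (t & Ht & Hd).
  rewrite INR_IZR_INZ in HN1, Ht. apply le_IZR in Ht.
  pose proof (gp_move_r (cayley Gam Sg Gen) (l (sg * Z.of_nat n)%Z) (l t) (p (sg * Z.of_nat m)%Z) (l 0%Z)) as G.
  change (gp (cayley Gam Sg Gen)) with gpr in G. change (@dist (cayley Gam Sg Gen)) with d in G.
  rewrite (sym (l t)) in G. unfold gpS at 1 in G. rewrite !Hl in G.
  assert (IZR (Z.of_nat N1) * 2 <= IZR (Z.abs (sg * Z.of_nat n - 0)) + IZR (Z.abs (t - 0)) - IZR (Z.abs (sg * Z.of_nat n - t))).
  { rewrite <- plus_IZR, <- minus_IZR, <- mult_IZR. apply IZR_le. destruct Hsg; subst sg; lia. }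
  pose proof (Rmax_r 0 M). lra.
Qed.

(* Limit of geodesic segments from p(-n) to p(n); by the product bound they all pass near p(0). *)
Theorem limit_geodesic (p : Z -> Gam) D :
  (forall m k n, (m <= k <= n)%Z -> gpr (p m) (p n) (p k) <= D) ->
  (forall M, exists N, forall n, (N <= n)%nat ->
     M <= d (p 0%Z) (p (Z.of_nat n)) /\ M <= d (p 0%Z) (p (- Z.of_nat n)%Z)) ->
  exists l : Z -> Gam,
    (forall m n, d (l m) (l n) = IZR (Z.abs (m - n))) /\
    (forall k, exists t, d (p k) (l t) <= D + 2 * delta + 1) /\
    same_end Gam Sg (fun n => l (Z.of_nat n)) (fun n => p (Z.of_nat n)) /\
    same_end Gam Sg (fun n => l (- Z.of_nat n)%Z) (fun n => p (- Z.of_nat n)%Z).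
Proof.
  intros HD Hinf. set (D1 := D + 2 * delta + 1).
  destruct (choice (fun (n : nat) (abr : Z * Z * (Z -> Gam)) =>
    let '(a, b, r) := abr in
    (0 <= a)%Z /\ (0 <= b)%Z /\ r (- a)%Z = p (- Z.of_nat n)%Z /\ r b = p (Z.of_nat n) /\
    (forall s t, d (r s) (r t) <= IZR (Z.abs (s - t))) /\
    (forall s t, (- a <= s <= b)%Z -> (- a <= t <= b)%Z -> d (r s) (r t) = IZR (Z.abs (s - t))) /\
    d (p 0%Z) (r 0%Z) <= D1 /\
    (forall k, (- Z.of_nat n <= k <= Z.of_nat n)%Z -> exists t, (- a <= t <= b)%Z /\ d (p k) (r t) <= D1)))
    as [seg Hseg].
  { intros n. destruct (centered_segment (p (- Z.of_nat n)%Z) (p (Z.of_nat n)) (p 0%Z))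
      as (a & b & r & H1 & H2 & H3 & H4 & H5 & H6 & H7 & H8).
    exists (a, b, r). do 6 (split; [assumption|]). split.
    - pose proof (HD (- Z.of_nat n)%Z 0%Z (Z.of_nat n) ltac:(lia)). unfold D1. lra.
    - intros k Hk. destruct (H8 (p k)) as (t & Ht & Hd). exists t. split; auto.
      pose proof (HD (- Z.of_nat n)%Z k (Z.of_nat n) ltac:(lia)). unfold D1. lra. }
  set (A := fun n => fst (fst (seg n))). set (B := fun n => snd (fst (seg n))). set (r := fun n => snd (seg n)).
  assert (Hs : forall n,
    (0 <= A n)%Z /\ (0 <= B n)%Z /\ r n (- A n)%Z = p (- Z.of_nat n)%Z /\ r n (B n) = p (Z.of_nat n) /\
    (forall s t, d (r n s) (r n t) <= IZR (Z.abs (s - t))) /\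
    (forall s t, (- A n <= s <= B n)%Z -> (- A n <= t <= B n)%Z -> d (r n s) (r n t) = IZR (Z.abs (s - t))) /\
    d (p 0%Z) (r n 0%Z) <= D1 /\
    (forall k, (- Z.of_nat n <= k <= Z.of_nat n)%Z -> exists t, (- A n <= t <= B n)%Z /\ d (p k) (r n t) <= D1)).
  { intros n. specialize (Hseg n). unfold A, B, r. destruct (seg n) as [[a b] r']. exact Hseg. }
  clearbody A B r. clear Hseg.
  (* At time [t] every segment lies in the finite ball of radius [D1 + |t|] about [p 0]. Positive
     and negative times are paired so that [konig] can index by [nat]. *)
  assert (Hlim : exists l : Z -> Gam, forall T N : nat, exists n, (N <= n)%nat /\
    forall z, (Z.abs z <= Z.of_nat T)%Z -> r n z = l z).
  { destruct (choice _ (fun t : nat => ball_finite_at Gam Sg Gen (p 0%Z) (D1 + INR t))) as [ball Hball].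
    destruct (konig (fun n t => (r n (Z.of_nat t), r n (- Z.of_nat t)%Z))
      (fun t => list_prod (ball t) (ball t))) as [lam Hlam].
    { intros n t. destruct (Hs n) as (_ & _ & _ & _ & H5 & _ & H7 & _).
      apply in_prod; apply Hball;
      [pose proof (tri (p 0%Z) (r n 0%Z) (r n (Z.of_nat t))) as T1; pose proof (H5 0%Z (Z.of_nat t)) as T2
      |pose proof (tri (p 0%Z) (r n 0%Z) (r n (- Z.of_nat t)%Z)) as T1; pose proof (H5 0%Z (- Z.of_nat t)%Z) as T2];
      match type of T2 with _ <= IZR ?e => replace e with (Z.of_nat t) in T2 by lia end;
      rewrite INR_IZR_INZ; lra. }
    exists (fun z => if (0 <=? z)%Z then fst (lam (Z.to_nat z)) else snd (lam (Z.to_nat (- z)))).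
    intros T N. destruct (Hlam (S T) N) as (n & Hn & Ha). exists n. split; auto.
    intros z Hz. destruct (Z.leb_spec 0 z).
    - rewrite <- Ha by lia. simpl. f_equal. lia.
    - rewrite <- Ha by lia. simpl. f_equal. lia. }
  destruct Hlim as [l Hl].
  (* The ends of [p] go to infinity, so late segments are geodesic on the whole window [[-T, T]]. *)
  assert (Hgeo : forall m n, d (l m) (l n) = IZR (Z.abs (m - n))).
  { intros m n. set (T := Z.to_nat (Z.max (Z.abs m) (Z.abs n))).
    destruct (Hinf (D1 + INR T)) as [N HN]. destruct (Hl T N) as (k & Hk & E).
    rewrite <- !E by lia. destruct (Hs k) as (H1 & H2 & H3 & H4 & H5 & H6 & H7 & H8).
    destruct (HN k Hk) as [I1 I2].
    pose proof (tri (p 0%Z) (r k 0%Z) (r k (B k))) as T1.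
    pose proof (tri (p 0%Z) (r k 0%Z) (r k (- A k)%Z)) as T2.
    rewrite <- H4 in I1. rewrite <- H3 in I2. rewrite H6 in T1, T2 by lia.
    replace (Z.abs (0 - B k)) with (B k) in T1 by lia. replace (Z.abs (0 - - A k)) with (A k) in T2 by lia.
    rewrite INR_IZR_INZ in I1, I2.
    assert (Z.of_nat T <= B k)%Z by (apply le_IZR; lra).
    assert (Z.of_nat T <= A k)%Z by (apply le_IZR; lra).
    apply H6; lia. }
  (* The lower bounds on [t] send the two halves of [p] to the correct ends of [l]. For [k >= 0],
     the bounded product at [p 0] makes the distance from [p (-n)] to [p k] nearly the sum through
     [p 0]; reading positions on the segment from [p (-n)] then bounds [t] below. The other case is
     symmetric. *)
  assert (Hnear : forall k, exists t, d (p k) (l t) <= D1 /\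
    ((0 <= k)%Z -> d (p 0%Z) (p k) - 2 * D - 2 * D1 <= IZR t) /\
    ((k <= 0)%Z -> d (p 0%Z) (p k) - 2 * D - 2 * D1 <= - IZR t)).
  { intros k. destruct (INR_unbounded (D1 + d (p 0%Z) (p k) + D1)) as [T HT].
    destruct (Hl T (Z.to_nat (Z.abs k))) as (n & Hn & E).
    destruct (Hs n) as (H1 & H2 & H3 & H4 & H5 & H6 & H7 & H8).
    destruct (H8 k ltac:(lia)) as (t & Ht & Hd).
    pose proof (H6 0%Z t ltac:(lia) Ht) as E0.
    pose proof (tri (r n 0%Z) (p 0%Z) (r n t)) as T1. pose proof (tri (p 0%Z) (p k) (r n t)) as T2.
    rewrite (sym (r n 0%Z) (p 0%Z)) in T1.
    assert (HtT : (Z.abs t <= Z.of_nat T)%Z).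
    { apply le_IZR. rewrite <- INR_IZR_INZ.
      replace (Z.abs (0 - t)) with (Z.abs t) in E0 by lia. lra. }
    exists t. rewrite <- E by auto. split; [exact Hd|]. split; intros Hk.
    - pose proof (HD (- Z.of_nat n)%Z 0%Z k ltac:(lia)) as P. unfold gpS in P. rewrite <- H3 in P.
      pose proof (H6 (- A n)%Z 0%Z ltac:(lia) ltac:(lia)) as E1. pose proof (H6 (- A n)%Z t ltac:(lia) Ht) as E2.
      replace (Z.abs (- A n - 0)) with (A n) in E1 by lia.
      replace (Z.abs (- A n - t)) with (A n + t)%Z in E2 by lia. rewrite plus_IZR in E2.
      pose proof (tri (r n (- A n)%Z) (p 0%Z) (r n 0%Z)) as T3.
      pose proof (tri (r n (- A n)%Z) (r n t) (p k)) as T4.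
      rewrite (sym (r n t)) in T4. rewrite (sym (p k) (p 0%Z)) in P. lra.
    - pose proof (HD k 0%Z (Z.of_nat n) ltac:(lia)) as P. unfold gpS in P. rewrite <- H4 in P.
      pose proof (H6 0%Z (B n) ltac:(lia) ltac:(lia)) as E1. pose proof (H6 t (B n) Ht ltac:(lia)) as E2.
      replace (Z.abs (0 - B n)) with (B n) in E1 by lia.
      replace (Z.abs (t - B n)) with (B n - t)%Z in E2 by lia. rewrite minus_IZR in E2.
      pose proof (tri (r n 0%Z) (p 0%Z) (r n (B n))) as T3.
      pose proof (tri (p k) (r n t) (r n (B n))) as T4.
      rewrite (sym (r n 0%Z) (p 0%Z)) in T3. rewrite (sym (r n (B n)) (p 0%Z)), (sym (p k) (p 0%Z)) in P. lra. }
  exists l. split; [exact Hgeo|]. split.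
  { intros k. destruct (Hnear k) as (t & Ht & _). exists t. exact Ht. }
  split.
  - intros M.
    destruct (same_end_of_near l p 1 D1 ltac:(lia) Hgeo) with (M := M) as [N HN].
    { intros M'. destruct (Hinf (M' + 2 * D + 2 * D1)) as [N HN]. exists N. intros n Hn.
      destruct (Hnear (Z.of_nat n)) as (t & Ht & Hp & _). exists t.
      destruct (HN n Hn) as [I _]. specialize (Hp ltac:(lia)).
      rewrite !Z.mul_1_l. split; [lra|exact Ht]. }
    exists N. intros n m Hn Hm. specialize (HN n m Hn Hm). rewrite !Z.mul_1_l in HN. exact HN.
  - intros M.
    destruct (same_end_of_near l p (-1) D1 ltac:(lia) Hgeo) with (M := M) as [N HN].
    { intros M'. destruct (Hinf (M' + 2 * D + 2 * D1)) as [N HN]. exists N. intros n Hn.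
      destruct (Hnear (- Z.of_nat n)%Z) as (t & Ht & _ & Hp). exists t.
      destruct (HN n Hn) as [_ I]. specialize (Hp ltac:(lia)).
      replace (-1 * t)%Z with (- t)%Z by lia. rewrite opp_IZR.
      replace (-1 * Z.of_nat n)%Z with (- Z.of_nat n)%Z by lia. split; [lra|exact Ht]. }
    exists N. intros n m Hn Hm. specialize (HN n m Hn Hm).
    replace (-1 * Z.of_nat n)%Z with (- Z.of_nat n)%Z in HN by lia.
    replace (-1 * Z.of_nat m)%Z with (- Z.of_nat m)%Z in HN by lia. exact HN.
Qed.

End CayleyHyperbolic.

(** * Automorphisms and axes *)

Lemma Rinv_mul_le K a b : 0 < K -> a <= K * b -> / K * a <= b.
Proof.
  intros HK H. apply Rmult_le_reg_l with K; auto. rewrite <- Rmult_assoc, Rinv_r by lra. lra.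
Qed.

Lemma Rmul_le_of_inv K a b : 0 < K -> / K * a <= b -> a <= K * b.
Proof.
  intros HK H. apply Rmult_le_compat_l with (r := K) in H; [|lra].
  rewrite <- Rmult_assoc, Rinv_r in H by lra. lra.
Qed.

Section Automorphisms.
Variables (Gam : Grp) (Sg : list Gam).
Hypothesis Gen : generates Gam Sg.
Variable delta : R.
Hypothesis Hyp : hyp_with (cayley Gam Sg Gen) delta.

Notation d := (dS Gam Sg).
Notation gpr := (gpS Gam Sg).
Notation wl := (wlen Gam Sg).
Let sym := dS_sym Gam Sg Gen.
Let tri := dS_tri Gam Sg Gen.
Let Geo := cayley_chain_geodesic Gam Sg Gen.

Lemma aut_bilipschitz f : is_aut Gam f ->
  exists K, 1 <= K /\ forall g h, d (f g) (f h) <= K * d g h /\ d g h <= K * d (f g) (f h).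
Proof.
  intros Hf. destruct (aut_inverse _ f Hf) as (f' & Hf' & E1 & E2).
  destruct (hom_lipschitz Gam Sg Gen f (proj1 Hf)) as (K & HK & H).
  destruct (hom_lipschitz Gam Sg Gen f' (proj1 Hf')) as (K' & HK' & H').
  exists (Rmax K K'). pose proof (Rmax_l K K'). pose proof (Rmax_r K K'). split; [lra|].
  intros g h. specialize (H g h). specialize (H' (f g) (f h)). rewrite !E2 in H'.
  pose proof (dS_nonneg Gam Sg g h). pose proof (dS_nonneg Gam Sg (f g) (f h)).
  split; nra.
Qed.

(** A large product at [gone] keeps the geodesic from [u n] to [v m] far from [gone]. Its image is a
    quasi-geodesic, still far up to the factor [K], and [quasi_geodesic_far] turns this back into a
    large product. *)
Lemma same_end_bilipschitz f K (u v : nat -> Gam) :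
  1 <= K -> f gone = gone ->
  (forall g h, d (f g) (f h) <= K * d g h /\ d g h <= K * d (f g) (f h)) ->
  same_end Gam Sg u v -> same_end Gam Sg (fun n => f (u n)) (fun n => f (v n)).
Proof.
  intros HK H1 Hf Huv M.
  destruct (quasi_geodesic_far _ delta Hyp Geo K 0 HK ltac:(lra)) as [D HD].
  destruct (Huv (K * (M + D))) as [N HN]. exists N. intros n m Hn Hm.
  specialize (HN n m Hn Hm).
  destruct (cayley_geodesic Gam Sg Gen (u n) (v m)) as (k & q & Ek & q0 & qk & Hq).
  assert (F : M + D - D <= gpr (f (q 0%nat)) (f (q k)) gone).
  { apply (HD k (fun i => f (q i)) gone (M + D)).
    - intros i j Hij Hj _. destruct (Hf (q i) (q j)) as [A B]. rewrite Hq in A, B by auto.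
      simpl. split; [|lra]. pose proof (Rinv_mul_le K _ _ ltac:(lra) B). lra.
    - intros i Hi. destruct (Hf gone (q i)) as [_ B]. rewrite H1 in B.
      pose proof (gp_move_base (cayley Gam Sg Gen) (u n) (v m) gone (q i)) as G.
      change (gp (cayley Gam Sg Gen)) with gpr in G. change (@dist (cayley Gam Sg Gen)) with d in *.
      assert (Z0 : gpr (u n) (v m) (q i) = 0).
      { unfold gpS. rewrite <- q0, <- qk, (sym (q k) (q i)), !Hq by lia.
        rewrite !minus_INR by lia. lra. }
      apply Rmult_le_reg_l with K; lra. }
  rewrite q0, qk in F. lra.
Qed.

(** [D] depends on [f] alone, so that stability constants transported by [f] stay uniform over all
    axes. *)
Lemma aut_moves_axis f : is_aut Gam f ->
  exists D, 0 <= D /\ forall a l, in_LS Gam Sg a l ->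
    exists l', in_LS Gam Sg (f a) l' /\ forall k, exists t, d (f (l k)) (l' t) <= D.
Proof.
  intros Hf. destruct (aut_bilipschitz f Hf) as (K & HK & HfK).
  assert (Hf1 : f gone = gone) by apply hom_one, Hf.
  destruct (local_to_global_Z _ delta Hyp Geo K 0 HK ltac:(lra))
    as (L & K' & C' & D & HL & HK' & HC' & HD & HG).
  exists (D + 2 * delta + 1). split; [pose proof (proj1 Hyp); lra|].
  intros a l (Hl & Hp & Hm).
  assert (Hql : forall m n, / K * IZR (Z.abs (m - n)) <= d (f (l m)) (f (l n)) <= K * IZR (Z.abs (m - n))).
  { intros m n. destruct (HfK (l m) (l n)) as [A B]. rewrite Hl in A, B. split; [|lra].
    apply Rinv_mul_le; lra. }
  destruct (HG (fun n => f (l n))) as [_ HD'].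
  { intros m n Hmn. specialize (Hql m n). replace (Z.abs (m - n)) with (n - m)%Z in Hql by lia.
    simpl. lra. }
  destruct (limit_geodesic Gam Sg Gen delta Hyp (fun n => f (l n)) D HD') as (l' & Hl' & Hn & Hp' & Hm').
  { intros M. destruct (INR_unbounded (K * Rmax 0 M)) as [N HN]. exists N. intros n HNn.
    apply le_INR in HNn. rewrite (INR_IZR_INZ n) in HNn.
    pose proof (Rmax_r 0 M). pose proof (Rmax_l 0 M).
    assert (M <= / K * IZR (Z.of_nat n)).
    { apply Rmult_le_reg_l with K; [lra|]. rewrite <- Rmult_assoc, Rinv_r by lra. nra. }
    pose proof (Hql 0%Z (Z.of_nat n)) as A. pose proof (Hql 0%Z (- Z.of_nat n)%Z) as B.
    replace (Z.abs (0 - Z.of_nat n)) with (Z.of_nat n) in A by lia.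
    replace (Z.abs (0 - - Z.of_nat n)) with (Z.of_nat n) in B by lia. lra. }
  exists l'. split; [|exact Hn]. split; [exact Hl'|]. split.
  - apply (same_end_trans Gam Sg Gen delta Hyp) with (1 := Hp').
    (* Distance 0 encodes the pointwise equality of [f (a^n)] and [(f a)^n], so no equality of
       functions is required. *)
    apply (same_end_move_r Gam Sg Gen) with (fun n => f (gpow Gam a n)) 0.
    + intros n. rewrite hom_pow by apply Hf. rewrite dS_refl by exact Gen. lra.
    + exact (same_end_bilipschitz f K _ _ HK Hf1 HfK Hp).
  - apply (same_end_trans Gam Sg Gen delta Hyp) with (1 := Hm').
    apply (same_end_move_r Gam Sg Gen) with (fun n => f (ginv (gpow Gam a n))) 0.
    + intros n. rewrite hom_inv, hom_pow by apply Hf. rewrite dS_refl by exact Gen. lra.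
    + exact (same_end_bilipschitz f K _ _ HK Hf1 HfK Hm).
Qed.

(* Concatenated translates of a geodesic [x,bx], for x with minimal displacement, form an N-local geodesic: d(p(n),p(n+N)) = d(p(n),b p(n)) >= N. *)
Lemma periodic_local_geodesic b x N :
  (1 <= N)%nat -> d x (gmul b x) = INR N -> (forall y, INR N <= d y (gmul b y)) ->
  exists p : Z -> Gam,
    (forall i, p (i * Z.of_nat N)%Z = gmul (zpow Gam b i) x) /\
    (forall m n, (m <= n <= m + Z.of_nat N)%Z -> d (p m) (p n) = IZR (n - m)).
Proof.
  intros HN Hx Hmin.
  destruct (cayley_geodesic Gam Sg Gen x (gmul b x)) as (N' & q & E & q0 & qN & Hq).
  rewrite E in Hx. apply INR_eq in Hx. subst N'. clear E.
  set (z := Z.of_nat N). assert (Hz : (1 <= z)%Z) by lia.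
  set (p := fun n => gmul (zpow Gam b (n / z)) (q (Z.to_nat (n mod z)))).
  assert (Hp : forall k r, (0 <= r < z)%Z -> p (k * z + r)%Z = gmul (zpow Gam b k) (q (Z.to_nat r))).
  { intros k r Hr. unfold p. rewrite Z.div_add_l, Z.div_small, Z.add_0_r by lia.
    rewrite Z.add_comm, Z.mod_add, Z.mod_small by lia. reflexivity. }
  assert (Hstep : forall n, d (p n) (p (n + 1)%Z) <= 1).
  { intros n. pose proof (Z.div_mod n z ltac:(lia)) as En. pose proof (Z.mod_pos_bound n z ltac:(lia)).
    set (k := (n / z)%Z) in *. set (r := (n mod z)%Z) in *.
    replace n with (k * z + r)%Z by lia. rewrite Hp by lia.
    destruct (Z.eq_dec (r + 1) z) as [Er|Er].
    (* At the seam the next translate begins at [b^(k+1) x = b^k (b x)], the last point of the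
       current one, because [b] commutes with its powers. *)
    - replace (k * z + r + 1)%Z with ((k + 1) * z + 0)%Z by lia. rewrite Hp by lia.
      assert (Ec : gmul (zpow Gam b (k + 1)) (q (Z.to_nat 0)) = gmul (zpow Gam b k) (q N)).
      { simpl Z.to_nat. rewrite q0, qN, gassoc. f_equal. rewrite zpow_succ.
        unfold zpow. destruct (0 <=? k)%Z; [apply gpow_comm|].
        pose proof (gpow_comm Gam b (Z.to_nat (- k))) as Ec.
        set (c := gpow Gam b (Z.to_nat (- k))) in *.
        rewrite <- (gmul_inv_l_cancel _ c (gmul b (ginv c))).
        rewrite (gassoc _ c b), <- Ec, <- (gassoc _ b), ginv_r, gone_r. reflexivity. }
      rewrite Ec, dS_left, Hq by lia. replace (N - Z.to_nat r)%nat with 1%nat by lia. simpl. lra.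
    - rewrite <- Z.add_assoc, Hp by lia. rewrite dS_left, Hq by lia.
      replace (Z.to_nat (r + 1) - Z.to_nat r)%nat with 1%nat by lia. simpl. lra. }
  assert (Hlip : forall k m, d (p m) (p (m + Z.of_nat k)%Z) <= IZR (Z.of_nat k)).
  { induction k as [|k IH]; intros m.
    - simpl. rewrite Z.add_0_r, dS_refl by exact Gen. lra.
    - specialize (IH m). specialize (Hstep (m + Z.of_nat k)%Z).
      replace (m + Z.of_nat (S k))%Z with (m + Z.of_nat k + 1)%Z by lia.
      pose proof (tri (p m) (p (m + Z.of_nat k)%Z) (p (m + Z.of_nat k + 1)%Z)).
      rewrite Nat2Z.inj_succ, succ_IZR. lra. }
  assert (Hper : forall n, p (n + z)%Z = gmul b (p n)).
  { intros n. unfold p. replace (n + z)%Z with (n + 1 * z)%Z by lia.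
    rewrite Z.div_add, Z.mod_add, zpow_succ, gassoc by lia. reflexivity. }
  exists p. split.
  - intros i. fold z. replace (i * z)%Z with (i * z + 0)%Z by lia. rewrite Hp by lia.
    simpl Z.to_nat. rewrite q0. reflexivity.
  - intros m n Hmn. fold z in Hmn. specialize (Hmin (p m)). rewrite <- Hper in Hmin.
    pose proof (tri (p m) (p n) (p (m + z)%Z)).
    pose proof (Hlip (Z.to_nat (n - m)) m) as A. pose proof (Hlip (Z.to_nat (m + z - n)) n) as B.
    rewrite Z2Nat.id in A, B by lia.
    replace (m + (n - m))%Z with n in A by lia. replace (n + (m + z - n))%Z with (m + z)%Z in B by lia.
    rewrite INR_IZR_INZ in Hmin. fold z in Hmin. rewrite !minus_IZR, ?plus_IZR in *. lra.
Qed.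

Lemma minimal_displacement (b : Gam) : exists x N,
  d x (gmul b x) = INR N /\ forall y, INR N <= d y (gmul b y).
Proof.
  destruct (dec_inh_nat_subset_has_unique_least_element
    (fun n => exists x, wl (gmul (ginv x) (gmul b x)) = n) (fun n => classic _)
    (ex_intro _ _ (ex_intro _ gone eq_refl))) as (N & ((x & Hx) & Hmin) & _).
  exists x, N. split; [unfold dS; rewrite Hx; reflexivity|].
  intros y. apply le_INR, Hmin. exists y. reflexivity.
Qed.

(** The constants precede [b]: one threshold and one rate of growth serve all elements of large
    translation length. The threshold is the local scale that [local_to_global_Z] asks of geodesics,
    [K = 1] and [C = 0]. *)
Lemma long_translation_axis :
  exists (N0 : nat) (K C D : R), 1 <= K /\ 0 <= C /\
    forall b, trlen_ge Gam Sg b (INR N0) ->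
      infinite_order Gam b /\
      exists (x : Gam) (l : Z -> Gam), in_LS Gam Sg b l /\
        (forall i : nat, exists t, d (gmul (gpow Gam b i) x) (l t) <= D) /\
        (forall i : nat, / K * (INR i * d x (gmul b x)) - C <= d x (gmul (gpow Gam b i) x)).
Proof.
  destruct (local_to_global_Z _ delta Hyp Geo 1 0 ltac:(lra) ltac:(lra))
    as (L & K & C & D & HL & HK & HC & HD & HG).
  exists (Z.to_nat L), K, C, (D + 2 * delta + 1). split; [exact HK|]. split; [exact HC|].
  intros b Hb. destruct (minimal_displacement b) as (x & N & Hx & Hmin).
  assert (HNL : (Z.to_nat L <= N)%nat).
  { apply INR_le. rewrite <- Hx. apply Rge_le, Hb. }
  assert (HN1 : (1 <= N)%nat) by lia.
  destruct (periodic_local_geodesic b x N HN1 Hx Hmin) as (p & Hp & Hloc).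
  destruct (HG p) as [HQ HP].
  { intros m n Hmn. simpl. rewrite Hloc by lia. rewrite Rinv_1. lra. }
  simpl in HQ. change (gp (cayley Gam Sg Gen)) with gpr in HP.
  assert (Hpow : forall i : nat, zpow Gam b (Z.of_nat i) = gpow Gam b i).
  { intros i. unfold zpow. destruct (Z.leb_spec 0 (Z.of_nat i)); [|lia]. rewrite Nat2Z.id. reflexivity. }
  assert (p0 : p 0%Z = x).
  { rewrite <- (Z.mul_0_l (Z.of_nat N)), Hp. apply gone_l. }
  assert (Hneg : forall i : nat, zpow Gam b (- Z.of_nat i) = ginv (gpow Gam b i)).
  { intros i. unfold zpow. destruct (Z.leb_spec 0 (- Z.of_nat i)).
    - replace i with 0%nat by lia. simpl. symmetry. apply ginv_one.
    - rewrite Z.opp_involutive, Nat2Z.id. reflexivity. }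
  assert (Hlow : forall i : nat, / K * (INR i * d x (gmul b x)) - C <= d x (gmul (gpow Gam b i) x)).
  { intros i. rewrite Hx, <- Hpow, <- Hp, <- p0, !INR_IZR_INZ, <- mult_IZR.
    specialize (HQ 0%Z (Z.of_nat i * Z.of_nat N)%Z ltac:(lia)). rewrite Z.sub_0_r in HQ. exact HQ. }
  split.
  (* If [b^n = 1], then [b^(n k)] fixes [x] for every [k], against linear growth. *)
  { intros n Hn E. destruct (INR_unbounded (K * C)) as [k Hk].
    specialize (Hlow (n * k)%nat). rewrite gpow_mult_one, gone_l, dS_refl in Hlow by auto.
    assert (/ K * (INR (n * k) * d x (gmul b x)) <= C) as Hl by lra.
    apply Rmul_le_of_inv in Hl; [|lra]. rewrite Hx, <- mult_INR in Hl.
    assert (INR k <= INR (n * k * N)) by (apply le_INR; apply Nat.le_trans with (n * k)%nat; nia). lra. }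
  destruct (limit_geodesic Gam Sg Gen delta Hyp p D HP) as (l & Hl & Hn & Hep & Hem).
  { intros M. destruct (INR_unbounded (K * (Rmax 0 M + C))) as [n0 Hn0].
    exists n0. intros n Hnn. apply le_INR in Hnn. rewrite (INR_IZR_INZ n) in Hnn.
    pose proof (Rmax_r 0 M). pose proof (Rmax_l 0 M).
    assert (M + C <= / K * IZR (Z.of_nat n)).
    { apply Rmult_le_reg_l with K; [lra|]. rewrite <- Rmult_assoc, Rinv_r by lra. nra. }
    pose proof (HQ 0%Z (Z.of_nat n) ltac:(lia)) as A. pose proof (HQ (- Z.of_nat n)%Z 0%Z ltac:(lia)) as B.
    rewrite Z.sub_0_r in A. replace (0 - - Z.of_nat n)%Z with (Z.of_nat n) in B by lia.
    rewrite (sym _ (p 0%Z)) in B. lra. }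
  exists x, l. split; [split; [exact Hl|split]|split; [|exact Hlow]].
  (* At multiples of [N] the path passes through [b^n x], whose distance to [b^n] is [d x gone]. *)
  - apply (same_end_move_r Gam Sg Gen) with (fun n => p (Z.of_nat (n * N))) (d x gone).
    + intros n. rewrite Nat2Z.inj_mul, Hp, Hpow. rewrite <- (gone_r _ (gpow Gam b n)) at 2.
      rewrite dS_left. lra.
    + apply (same_end_subseq_r Gam Sg _ (fun n => p (Z.of_nat n)) (fun n => (n * N)%nat)); auto.
      intros n. nia.
  - apply (same_end_move_r Gam Sg Gen) with (fun n => p (- Z.of_nat (n * N))%Z) (d x gone).
    + intros n. rewrite Nat2Z.inj_mul, <- Z.mul_opp_l, Hp, Hneg.
      rewrite <- (gone_r _ (ginv (gpow Gam b n))) at 2. rewrite dS_left. lra.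
    + apply (same_end_subseq_r Gam Sg _ (fun n => p (- Z.of_nat n)%Z) (fun n => (n * N)%nat)); auto.
      intros n. nia.
  - intros i. destruct (Hn (Z.of_nat i * Z.of_nat N)%Z) as [t Ht].
    exists t. rewrite Hp, Hpow in Ht. exact Ht.
Qed.

End Automorphisms.

(** * Stable representations *)

Section Representations.
Variables (Gam : Grp) (Sg : list Gam) (X : MSpace) (A : Gam -> Prop).
Hypothesis Gen : generates Gam Sg.

Notation d := (dS Gam Sg).
Notation wl := (wlen Gam Sg).
Notation Rp := (Rep Gam X).
Notation rep := (is_rep Gam X).
Implicit Types rho : Rp.

Lemma rep_isometry rho g x y : rep rho -> dist (rho g x) (rho g y) = dist x y.
Proof. intros [H _]. apply (H g). Qed.

Lemma rep_mul rho g h x : rep rho -> rho (gmul g h) x = rho g (rho h x).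
Proof. intros [_ H]. apply H. Qed.

Lemma rep_one rho x : rep rho -> rho gone x = x.
Proof.
  intros H. apply dist_eq0. rewrite <- (rep_isometry rho gone) by exact H.
  rewrite <- rep_mul, gone_l by exact H. apply dist_refl.
Qed.

Lemma rep_dist rho g h x : rep rho -> dist (rho g x) (rho h x) = dist x (rho (gmul (ginv g) h) x).
Proof.
  intros H. rewrite <- (rep_isometry rho g x) by exact H.
  rewrite <- rep_mul, gmul_inv_r_cancel by exact H. reflexivity.
Qed.

Lemma rep_displacement rho x M g : rep rho -> 0 <= M ->
  (forall s, In s Sg -> dist x (rho s x) <= M) -> dist x (rho g x) <= M * INR (wl g).
Proof.
  intros H HM Hs. apply (lipschitz_of_gens Gam Sg Gen (fun g => dist x (rho g x))); auto.
  - rewrite rep_one, dist_refl by exact H. lra.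
  - intros b s h Hin. specialize (Hs s Hin). rewrite rep_mul by exact H.
    pose proof (dist_tri X x (rho (letter Gam b s) x) (rho (letter Gam b s) (rho h x))) as T.
    rewrite rep_isometry in T by exact H.
    assert (dist x (rho (letter Gam b s) x) <= M).
    { destruct b; simpl; [exact Hs|].
      rewrite <- (rep_isometry rho s), <- rep_mul, ginv_r, rep_one, dist_sym by exact H. exact Hs. }
    lra.
Qed.

Lemma rep_lipschitz rho x M g h : rep rho -> 0 <= M ->
  (forall s, In s Sg -> dist x (rho s x) <= M) -> dist (rho g x) (rho h x) <= M * d g h.
Proof. intros H HM Hs. rewrite rep_dist by exact H. apply rep_displacement; auto. Qed.

(** Stability with explicit constants and base point. The upper quasi-geodesic bound is replaced by
    a bound on the generators, which makes the orbit map [M]-Lipschitz. *)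
Definition stable_at (K C M : R) (x : X) rho : Prop :=
  (forall s, In s Sg -> dist x (rho s x) <= M) /\
  forall a, A a -> infinite_order Gam a -> forall l, in_LS Gam Sg a l ->
    forall m n, (m <= n)%Z -> / K * IZR (n - m) - C <= dist (rho (l m) x) (rho (l n) x).

Lemma stable_at_mono K C M K' C' M' x rho :
  1 <= K -> K <= K' -> C <= C' -> M <= M' -> stable_at K C M x rho -> stable_at K' C' M' x rho.
Proof.
  intros HK HKK HC HM [H1 H2]. split.
  - intros s Hs. specialize (H1 s Hs). lra.
  - intros a Ha Hi l Hl m n Hmn. specialize (H2 a Ha Hi l Hl m n Hmn).
    assert (/ K' * IZR (n - m) <= / K * IZR (n - m)).
    { apply Rmult_le_compat_r; [apply IZR_le; lia|]. apply Rinv_le_contravar; lra. }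
    lra.
Qed.

Lemma A_stable_stable_at rho : A_stable Gam Sg X A rho ->
  exists K C M x, 1 <= K /\ 0 <= C /\ 1 <= M /\ stable_at K C M x rho.
Proof.
  intros (K & C & x & HK & HC & H).
  destruct (list_bound _ (fun s => dist x (rho s x)) Sg) as (M & HM & Hs).
  exists K, C, M, x. split; [lra|]. split; [lra|]. split; [lra|]. split; [exact Hs|].
  intros a Ha Hi l Hl m n Hmn. destruct (H a Ha Hi l Hl m n) as [L _].
  replace (Z.abs (m - n)) with (n - m)%Z in L by lia. exact L.
Qed.

Lemma stable_at_A_stable rho K C M x : rep rho ->
  1 <= K -> 0 <= C -> stable_at K C M x rho -> A_stable Gam Sg X A rho.
Proof.
  intros Hr HK HC HS.
  apply (stable_at_mono K C M (Rmax K M) C (Rmax K M)) in HS; try lra; try apply Rmax_l; try apply Rmax_r.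
  pose proof (Rmax_l K M) as HM. set (K1 := Rmax K M) in *. destruct HS as [H1 H2].
  exists K1, C, x. split; [lra|]. split; [lra|].
  intros a Ha Hi l Hl m n. split.
  - destruct (Z.le_ge_cases m n) as [Hmn|Hmn].
    + replace (Z.abs (m - n)) with (n - m)%Z by lia. apply (H2 a Ha Hi l Hl m n Hmn).
    + replace (Z.abs (m - n)) with (m - n)%Z by lia. rewrite dist_sym. apply (H2 a Ha Hi l Hl n m Hmn).
  - pose proof (rep_lipschitz rho x K1 (l m) (l n) Hr ltac:(lra) H1) as L.
    rewrite (proj1 Hl) in L. lra.
Qed.

Lemma A_stable_conj rho rho' :
  conj_rep Gam X rho rho' -> A_stable Gam Sg X A rho -> A_stable Gam Sg X A rho'.
Proof.
  intros (g & [Hg _] & Hc) (K & C & x & HK & HC & H).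
  exists K, C, (g x). split; [exact HK|]. split; [exact HC|].
  intros a Ha Hi l Hl m n. rewrite !Hc, Hg. apply (H a Ha Hi l Hl).
Qed.

Lemma S_A_iff rho : S_A Gam Sg X A rho <-> rep rho /\ A_stable Gam Sg X A rho.
Proof.
  split.
  - intros (Hr & rho' & _ & Hc & Hs). split; [exact Hr|]. exact (A_stable_conj _ _ Hc Hs).
  - intros [Hr Hs]. split; [exact Hr|]. exists rho. split; [exact Hr|]. split; [|exact Hs].
    exists (fun x => x). split; [|reflexivity]. split; [reflexivity|].
    intros y. exists y. reflexivity.
Qed.

(** * Neighbourhoods of a representation *)

Definition hom_nbhd rho (O : Rp -> Prop) : Prop :=
  exists l : list (Gam * (X -> Prop) * (X -> Prop)),
    (forall t, In t l -> subbasic Gam Sg X t /\ sat_sub Gam X t rho) /\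
    forall rho', rep rho' -> (forall t, In t l -> sat_sub Gam X t rho') -> O rho'.

Lemma hom_nbhd_mono rho (O O' : Rp -> Prop) :
  (forall rho', rep rho' -> O rho' -> O' rho') -> hom_nbhd rho O -> hom_nbhd rho O'.
Proof. intros HO (l & H1 & H2). exists l. auto. Qed.

Lemma hom_nbhd_and rho O O' : hom_nbhd rho O -> hom_nbhd rho O' ->
  hom_nbhd rho (fun rho' => O rho' /\ O' rho').
Proof.
  intros (l & H1 & H2) (l' & H1' & H2'). exists (l ++ l'). split.
  - intros t Ht. apply in_app_or in Ht. destruct Ht; auto.
  - intros rho' Hr Ht. split; [apply H2|apply H2']; auto; intros t Hin; apply Ht, in_or_app; auto.
Qed.

Lemma hom_nbhd_true rho (O : Rp -> Prop) : (forall rho', rep rho' -> O rho') -> hom_nbhd rho O.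
Proof. intros H. exists nil. split; [intros t []|auto]. Qed.

Lemma hom_nbhd_list {T : Type} (l : list T) rho (O : T -> Rp -> Prop) :
  (forall t, In t l -> hom_nbhd rho (O t)) ->
  hom_nbhd rho (fun rho' => forall t, In t l -> O t rho').
Proof.
  induction l as [|t l IH]; intros H.
  - apply hom_nbhd_true. intros rho' _ t [].
  - apply hom_nbhd_mono with (fun rho' => O t rho' /\ forall u, In u l -> O u rho').
    + intros rho' _ [H1 H2] u [<-|Hu]; auto.
    + apply hom_nbhd_and; [apply H; left; reflexivity|].
      apply IH. intros u Hu. apply H. right. exact Hu.
Qed.

(** This is the subbasic set given by the compact set [{z}] and an open ball. *)
Lemma hom_nbhd_gen rho s z eps : In s Sg -> 0 < eps ->
  hom_nbhd rho (fun rho' => dist (rho s z) (rho' s z) < eps).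
Proof.
  intros Hs He.
  exists ((s, eq z, fun u => dist (rho s z) u < eps) :: nil). split.
  - intros t [<-|[]]. split; [split; [exact Hs|split]|].
    + intros F _ Hcov. destruct (Hcov z eq_refl) as (U & HU & Hz).
      exists (U :: nil). split; [intros V [<-|[]]; exact HU|].
      intros u <-. exists U. split; [left; reflexivity|exact Hz].
    + intros u Hu. exists (eps - dist (rho s z) u). split; [lra|].
      intros v Hv. pose proof (dist_tri X (rho s z) u v). lra.
    + intros u <-. rewrite dist_refl. exact He.
  - intros rho' _ H. specialize (H _ (or_introl eq_refl)). simpl in H. apply H. reflexivity.
Qed.

(** Induction on a word for [g], halving [eps] at each letter. For an inverse letter, applying
    [rho' s] reduces the comparison of inverses at [u] to that of [s] at the point
    [rho (ginv s) u]. *)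
Lemma hom_nbhd_eval rho g z eps : rep rho -> 0 < eps ->
  hom_nbhd rho (fun rho' => dist (rho g z) (rho' g z) < eps).
Proof.
  intros Hr. destruct (Gen g) as (w & Hw & <-). revert eps.
  induction w as [|[b s] w IH]; intros eps He; simpl.
  - apply hom_nbhd_true. intros rho' Hr'. rewrite !rep_one, dist_refl by assumption. exact He.
  - set (v := wprod Gam w) in *.
    specialize (IH ltac:(intros p Hp; apply Hw; right; exact Hp) (eps / 2) ltac:(lra)).
    assert (Hs : In s Sg) by (apply (Hw (b, s)); left; reflexivity).
    assert (HL : hom_nbhd rho (fun rho' => dist (rho (letter Gam b s) (rho v z)) (rho' (letter Gam b s) (rho v z)) < eps / 2)).
    { destruct b; simpl; [apply hom_nbhd_gen; auto; lra|].
      apply hom_nbhd_mono with (2 := hom_nbhd_gen rho s (rho (ginv s) (rho v z)) (eps / 2) Hs ltac:(lra)).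
      intros rho' Hr' H.
      rewrite <- (rep_mul rho s), ginv_r, rep_one in H by exact Hr.
      rewrite <- (rep_isometry rho' s), <- (rep_mul rho' s (ginv s)), ginv_r, rep_one, dist_sym by exact Hr'.
      exact H. }
    apply hom_nbhd_mono with (2 := hom_nbhd_and _ _ _ IH HL).
    intros rho' Hr' [H1 H2]. rewrite (rep_mul rho), (rep_mul rho') by assumption.
    pose proof (dist_tri X (rho (letter Gam b s) (rho v z)) (rho' (letter Gam b s) (rho v z))
      (rho' (letter Gam b s) (rho' v z))) as T.
    rewrite (rep_isometry rho') in T by exact Hr'. lra.
Qed.

(* The base point is existentially quantified to make the set invariant under conjugation. *)
Definition displacement_nbhd (L : nat) rho (x : X) rho' : Prop :=
  rep rho' /\ exists y, forall g, (wl g <= L)%nat ->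
    Rabs (dist y (rho' g y) - dist x (rho g x)) < 1.

Lemma displacement_nbhd_self L rho x : rep rho -> displacement_nbhd L rho x rho.
Proof.
  intros H. split; [exact H|]. exists x. intros g _. rewrite Rminus_diag, Rabs_R0. lra.
Qed.

Lemma displacement_nbhd_open L rho x : quot_open Gam Sg X (displacement_nbhd L rho x).
Proof.
  split; [split|].
  - intros rho' [H _]. exact H.
  - intros r1 r2 _ H2 (f & [Hf _] & Hc) [_ (y & Hy)]. split; [exact H2|].
    exists (f y). intros g Hg. rewrite Hc, Hf. apply Hy, Hg.
  - intros r1 H1 [_ (y & Hy)].
    change (hom_nbhd r1 (displacement_nbhd L rho x)).
    destruct (ball_finite Gam Sg Gen L) as [B HB].
    apply hom_nbhd_mono with (fun r2 => forall g, In g B -> (wl g <= L)%nat ->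
      Rabs (dist y (r2 g y) - dist x (rho g x)) < 1).
    { intros r2 H2 H. split; [exact H2|]. exists y. intros g Hg. apply H; auto. }
    apply hom_nbhd_list. intros g _.
    destruct (classic (wl g <= L)%nat) as [Hg|Hg]; [|apply hom_nbhd_true; intros; contradiction].
    (* With [y] fixed, the strict inequality leaves the margin [1 - e] for moving the image of [y];
       finitely many [g] have to be controlled. *)
    specialize (Hy g Hg). set (e := Rabs (dist y (r1 g y) - dist x (rho g x))) in *.
    apply hom_nbhd_mono with (2 := hom_nbhd_eval r1 g y (1 - e) H1 ltac:(lra)).
    intros r2 _ H _.
    pose proof (dist_tri X y (r1 g y) (r2 g y)). pose proof (dist_tri X y (r2 g y) (r1 g y)) as T.
    rewrite (dist_sym X (r2 g y)) in T. unfold e, Rabs in *.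
    repeat destruct Rcase_abs; lra.
Qed.

(** * Openness, and uniform stability on compact sets *)

Section StableNeighbourhood.
Variable delta : R.
Hypothesis Hyp : hyp_with X delta.
Hypothesis Geo : chain_geodesic X.

(** For indices at most [L] apart on an axis, the distance of orbit points is the displacement by an
    element of length at most [L], and this changes by less than 1. The orbit is thus a local
    quasi-geodesic with [C + 1] in place of [C]. *)
Lemma displacement_nbhd_stable rho x K C M :
  1 <= K -> 0 <= C -> 1 <= M -> rep rho -> stable_at K C M x rho ->
  exists (L : nat) (K' C' : R), 1 <= K' /\ 0 <= C' /\
    forall rho', displacement_nbhd L rho x rho' -> exists y, stable_at K' C' (M + 1) y rho'.
Proof.
  intros HK HC HM Hr HS.
  destruct (local_to_global_Z X delta Hyp Geo (Rmax K (M + 1)) (C + 1)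
    ltac:(pose proof (Rmax_l K (M + 1)); lra) ltac:(lra))
    as (L & K' & C' & D & HL & HK' & HC' & _ & HG).
  apply (stable_at_mono K C M (Rmax K (M + 1)) C M) in HS; try lra; [|apply Rmax_l].
  pose proof (Rmax_r K (M + 1)) as HK1. set (K1 := Rmax K (M + 1)) in *.
  destruct HS as [Hs Hq].
  exists (Z.to_nat L), K', C'. split; [exact HK'|]. split; [exact HC'|].
  intros rho' [Hr' (y & Hy)]. exists y.
  (* Since [1 <= L], the generators are among the compared elements. *)
  assert (Hs' : forall s, In s Sg -> dist y (rho' s y) <= M + 1).
  { intros s Hin. pose proof (wlen_gen Gam Sg Gen s Hin).
    specialize (Hy s ltac:(lia)). specialize (Hs s Hin). unfold Rabs in Hy. destruct Rcase_abs in Hy; lra. }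
  split; [exact Hs'|].
  intros a Ha Hi l Hl. apply (HG (fun n => rho' (l n) y)).
  intros m n Hmn.
  assert (Ed : d (l m) (l n) = IZR (n - m)).
  { rewrite (proj1 Hl). f_equal. lia. }
  split.
  - specialize (Hq a Ha Hi l Hl m n ltac:(lia)).
    rewrite rep_dist in Hq |- * by assumption.
    specialize (Hy (gmul (ginv (l m)) (l n))).
    assert (Hw : (wl (gmul (ginv (l m)) (l n)) <= Z.to_nat L)%nat).
    { apply INR_le. unfold dS in Ed. rewrite Ed, INR_IZR_INZ. apply IZR_le. lia. }
    specialize (Hy Hw). unfold Rabs in Hy. destruct Rcase_abs in Hy; lra.
  - pose proof (rep_lipschitz rho' y (M + 1) (l m) (l n) Hr' ltac:(lra) Hs') as HLip.
    rewrite Ed in HLip. assert (0 <= IZR (n - m)) by (apply IZR_le; lia). nra.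
Qed.

Lemma S_A_open : quot_open Gam Sg X (S_A Gam Sg X A).
Proof.
  split; [split|].
  - intros rho [H _]. exact H.
  - intros r1 r2 _ H2 Hc H. apply S_A_iff in H. apply S_A_iff. split; [exact H2|].
    apply A_stable_conj with r1; tauto.
  - intros rho Hr H. apply S_A_iff in H. destruct H as [_ H].
    destruct (A_stable_stable_at rho H) as (K & C & M & x & HK & HC & HM & Hs).
    destruct (displacement_nbhd_stable rho x K C M HK HC HM Hr Hs) as (L & K' & C' & HK' & HC' & HN).
    change (hom_nbhd rho (S_A Gam Sg X A)).
    apply hom_nbhd_mono with (displacement_nbhd L rho x).
    + intros rho' Hr' Hn. destruct (HN rho' Hn) as [y Hy].
      apply S_A_iff. split; [exact Hr'|]. exact (stable_at_A_stable _ _ _ _ _ Hr' HK' HC' Hy).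
    + apply (displacement_nbhd_open L rho x); [exact Hr|]. apply displacement_nbhd_self, Hr.
Qed.

(** Displacement neighbourhoods are open in the quotient and carry fixed constants; a finite
    subcover allows taking maxima. The base point still varies with the representation. *)
Lemma compact_stable_uniform (Rc : Rp -> Prop) :
  (forall rho, Rc rho -> S_A Gam Sg X A rho) -> quot_compact Gam Sg X Rc ->
  exists K C M, 1 <= K /\ 0 <= C /\ 1 <= M /\ forall rho, Rc rho -> exists y, stable_at K C M y rho.
Proof.
  intros HS HR.
  destruct (HR (fun U => quot_open Gam Sg X U /\ exists K C M, 1 <= K /\ 0 <= C /\ 1 <= M /\
     forall rho, U rho -> exists y, stable_at K C M y rho)) as (l & Hl & Hcov).
  - intros U [H _]. exact H.
  - intros rho HRr. specialize (HS rho HRr). apply S_A_iff in HS. destruct HS as [Hr H].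
    destruct (A_stable_stable_at rho H) as (K & C & M & x & HK & HC & HM & Hs).
    destruct (displacement_nbhd_stable rho x K C M HK HC HM Hr Hs) as (L & K' & C' & HK' & HC' & HN).
    exists (displacement_nbhd L rho x). split; [|apply displacement_nbhd_self, Hr].
    split; [apply displacement_nbhd_open|]. exists K', C', (M + 1).
    split; [exact HK'|]. split; [exact HC'|]. split; [lra|exact HN].
  - assert (Hu : exists K C M, 1 <= K /\ 0 <= C /\ 1 <= M /\
      forall U, In U l -> forall rho, U rho -> exists y, stable_at K C M y rho).
    { clear Hcov. induction l as [|U l IH].
      - exists 1, 0, 1. split; [lra|]. split; [lra|]. split; [lra|]. intros U [].
      - destruct IH as (K & C & M & HK & HC & HM & H); [intros V HV; apply Hl; right; exact HV|].
        destruct (Hl U (or_introl eq_refl)) as (_ & K' & C' & M' & HK' & HC' & HM' & H').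
        exists (Rmax K K'), (Rmax C C'), (Rmax M M').
        pose proof (Rmax_l K K'). pose proof (Rmax_l C C'). pose proof (Rmax_l M M').
        pose proof (Rmax_r K K'). pose proof (Rmax_r C C'). pose proof (Rmax_r M M').
        split; [lra|]. split; [lra|]. split; [lra|].
        intros V [<-|HV] rho Hrho.
        + destruct (H' rho Hrho) as [y Hy]. exists y. apply stable_at_mono with K' C' M'; auto.
        + destruct (H V HV rho Hrho) as [y Hy]. exists y. apply stable_at_mono with K C M; auto. }
    destruct Hu as (K & C & M & HK & HC & HM & H). exists K, C, M.
    split; [exact HK|]. split; [exact HC|]. split; [exact HM|].
    intros rho Hrho. destruct (Hcov rho Hrho) as (U & HU & HUr). exact (H U HU rho HUr).
Qed.

End StableNeighbourhood.

(** * Stability under automorphisms, and translation lengths *)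

Section HyperbolicGroup.
Variable delta : R.
Hypothesis Hyp : hyp_with (cayley Gam Sg Gen) delta.

(** [rho'] along an axis of [a] is [rho] along its image under the inverse of [f], which is close to
    an axis of the image of [a], again in [A]. *)
Lemma stable_at_aut f rho rho' K C M x :
  is_aut Gam f -> (forall a, A a -> forall f, is_aut Gam f -> A (f a)) ->
  (forall g x, rho' (f g) x = rho g x) -> rep rho -> 1 <= K -> 0 <= C -> 1 <= M ->
  stable_at K C M x rho ->
  exists K' C' M', 1 <= K' /\ 0 <= C' /\ stable_at K' C' M' x rho'.
Proof.
  intros Hf HA Heq Hr HK HC HM [Hs Hq].
  destruct (aut_inverse _ f Hf) as (f' & Hf' & E1 & E2).
  destruct (aut_moves_axis Gam Sg Gen delta Hyp f' Hf') as (D & HD & Hax).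
  destruct (aut_bilipschitz Gam Sg Gen f' Hf') as (K2 & HK2 & Hlip).
  destruct (list_bound _ (fun s => dist x (rho' s x)) Sg) as (M' & HM' & Hs').
  (* The slopes compose. Moving both ends by [D] to the new axis costs [2 * D] of its length and
     [2 * (M * D)] in [X]. *)
  exists (K * K2), (/ K * (2 * D) + C + 2 * (M * D)), M'.
  assert (HKi : 0 < / K) by (apply Rinv_0_lt_compat; lra).
  split; [nra|]. split; [nra|]. split; [exact Hs'|].
  intros a Ha Hi l Hl m n Hmn.
  destruct (Hax a l Hl) as (l' & Hl' & Hn).
  destruct (Hn m) as [t Ht]. destruct (Hn n) as [u Hu].
  assert (Hrho : forall g, rho' g x = rho (f' g) x) by (intros g; rewrite <- Heq, E1; reflexivity).
  rewrite !Hrho.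
  pose proof (rep_lipschitz rho x M (f' (l m)) (l' t) Hr ltac:(lra) Hs) as A1.
  pose proof (rep_lipschitz rho x M (f' (l n)) (l' u) Hr ltac:(lra) Hs) as A2.
  assert (Q : / K * IZR (Z.abs (u - t)) - C <= dist (rho (l' t) x) (rho (l' u) x)).
  { assert (Ha' : A (f' a)) by (apply HA; auto).
    assert (Hi' : infinite_order Gam (f' a)) by (apply aut_infinite_order; auto).
    destruct (Z.le_ge_cases t u).
    - replace (Z.abs (u - t)) with (u - t)%Z by lia. eapply Hq; eauto.
    - replace (Z.abs (u - t)) with (t - u)%Z by lia. rewrite dist_sym. eapply Hq; eauto. }
  pose proof (proj1 Hl' t u) as Etu. replace (Z.abs (t - u)) with (Z.abs (u - t)) in Etu by lia.
  destruct (Hlip (l m) (l n)) as [_ B]. rewrite (proj1 Hl) in B.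
  replace (Z.abs (m - n)) with (n - m)%Z in B by lia.
  apply Rinv_mul_le in B; [|lra].
  pose proof (dS_tri Gam Sg Gen (f' (l m)) (l' t) (f' (l n))) as T1.
  pose proof (dS_tri Gam Sg Gen (l' t) (l' u) (f' (l n))) as T2.
  rewrite (dS_sym Gam Sg Gen (l' u)) in T2.
  assert (T : / K2 * IZR (n - m) - 2 * D <= IZR (Z.abs (u - t))) by lra.
  apply Rmult_le_compat_l with (r := / K) in T; [|lra].
  rewrite Rinv_mult.
  pose proof (dist_tri X (rho (l' t) x) (rho (f' (l m)) x) (rho (l' u) x)) as T3.
  pose proof (dist_tri X (rho (f' (l m)) x) (rho (f' (l n)) x) (rho (l' u) x)) as T4.
  rewrite (dist_sym X (rho (l' t) x) (rho (f' (l m)) x)) in T3.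
  assert (M * d (f' (l m)) (l' t) <= M * D) by (apply Rmult_le_compat_l; lra).
  assert (M * d (f' (l n)) (l' u) <= M * D) by (apply Rmult_le_compat_l; lra).
  lra.
Qed.

Lemma rep_pow_displacement rho b z i : rep rho ->
  dist z (rho (gpow Gam b i) z) <= INR i * dist z (rho b z).
Proof.
  intros Hr. induction i as [|i IH].
  - simpl. rewrite rep_one, dist_refl by exact Hr. lra.
  - rewrite S_INR. simpl gpow. rewrite rep_mul by exact Hr.
    pose proof (dist_tri X z (rho b z) (rho b (rho (gpow Gam b i) z))) as T.
    rewrite (rep_isometry rho b) in T by exact Hr. lra.
Qed.

Lemma linear_growth_compare a b c : (forall i : nat, INR i * a <= INR i * b + c) -> a <= b.
Proof.
  intros H. destruct (Rle_dec a b) as [|Hab]; auto. exfalso.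
  destruct (INR_unbounded (c / (a - b))) as [i Hi]. specialize (H i).
  assert (c / (a - b) * (a - b) = c) by (field; lra).
  assert (c / (a - b) * (a - b) < INR i * (a - b)) by (apply Rmult_lt_compat_r; lra). nra.
Qed.

(** Compare two growth rates of the orbit under [b^i]: stability along the axis of [b] bounds it
    below in terms of [d y (gmul b y)], and subadditivity bounds it above by the displacement of
    [z]. Additive errors vanish in the limit, so [z] may be arbitrary. [N0] and [K0] come before the
    representation and its constants. *)
Lemma stable_translation_length :
  exists (N0 : nat) (K0 : R), 1 <= K0 /\
    forall K C M x rho b z, 1 <= K -> 1 <= M -> rep rho -> stable_at K C M x rho -> A b ->
      trlen_ge Gam Sg b (INR N0) ->
      exists y, d y (gmul b y) <= K * (K0 * dist z (rho b z)).
Proof.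
  destruct (long_translation_axis Gam Sg Gen delta Hyp) as (N0 & K0 & C0 & D & HK0 & HC0 & Hax).
  exists N0, K0. split; [exact HK0|].
  intros K C M x rho b z HK HM Hr [Hs Hq] Hb HN.
  destruct (Hax b HN) as (Hi & y & l & Hl & Hnear & Hgrow).
  exists y. set (N := d y (gmul b y)) in *.
  destruct (Hnear 0%nat) as [t0 Ht0]. simpl in Ht0. rewrite gone_l in Ht0.
  (* The error term collects the distances to the axis, the additive constants and the change of
     base point from [rho y x] to [z]; it does not depend on [i]. *)
  apply (linear_growth_compare _ _
    (K0 * C0 + K0 * (2 * D) + K0 * (K * (C + 2 * (M * D) + 2 * dist (rho y x) z)))).
  intros i. destruct (Hnear i) as [t Ht]. specialize (Hgrow i).
  set (p := gmul (gpow Gam b i) y) in *.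
  assert (Q : / K * IZR (Z.abs (t - t0)) - C <= dist (rho (l t0) x) (rho (l t) x)).
  { destruct (Z.le_ge_cases t0 t).
    - replace (Z.abs (t - t0)) with (t - t0)%Z by lia. eapply Hq; eauto.
    - replace (Z.abs (t - t0)) with (t0 - t)%Z by lia. rewrite dist_sym. eapply Hq; eauto. }
  rewrite <- (proj1 Hl) in Q. rewrite (dS_sym Gam Sg Gen) in Q.
  pose proof (rep_lipschitz rho x M y (l t0) Hr ltac:(lra) Hs) as A1.
  pose proof (rep_lipschitz rho x M p (l t) Hr ltac:(lra) Hs) as A2.
  assert (M * d y (l t0) <= M * D) by (apply Rmult_le_compat_l; lra).
  assert (M * d p (l t) <= M * D) by (apply Rmult_le_compat_l; lra).
  pose proof (dist_tri X (rho (l t0) x) (rho y x) (rho (l t) x)) as T1.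
  pose proof (dist_tri X (rho y x) (rho p x) (rho (l t) x)) as T2.
  rewrite (dist_sym X (rho (l t0) x) (rho y x)) in T1.
  assert (T3 : dist (rho y x) (rho p x) <= 2 * dist (rho y x) z + INR i * dist z (rho b z)).
  { unfold p. rewrite rep_mul by exact Hr. set (v := rho y x).
    pose proof (dist_tri X v z (rho (gpow Gam b i) v)).
    pose proof (dist_tri X z (rho (gpow Gam b i) z) (rho (gpow Gam b i) v)) as T.
    rewrite (rep_isometry rho (gpow Gam b i) z v), (dist_sym X z v) in T by exact Hr.
    pose proof (rep_pow_displacement rho b z i Hr). lra. }
  pose proof (dS_tri Gam Sg Gen y (l t0) p) as S1.
  pose proof (dS_tri Gam Sg Gen (l t0) (l t) p) as S2.
  rewrite (dS_sym Gam Sg Gen (l t) p) in S2.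
  set (e := dist z (rho b z)) in *. set (r := dist (rho y x) z) in *.
  assert (Q' : d (l t0) (l t) <= K * (INR i * e + (C + 2 * (M * D) + 2 * r))).
  { rewrite (dS_sym Gam Sg Gen (l t0)). rewrite (dS_sym Gam Sg Gen (l t0)) in Q.
    apply Rmul_le_of_inv; lra. }
  assert (G : / K0 * (INR i * N) <= C0 + 2 * D + K * (INR i * e + (C + 2 * (M * D) + 2 * r))) by lra.
  apply Rmul_le_of_inv in G; [|lra].
  ring_simplify in G. ring_simplify. lra.
Qed.

End HyperbolicGroup.
End Representations.

(** * Infinitely many outer classes, and proper discontinuity *)

Lemma out_eq_sequence (Gam : Grp) (P : (Gam -> Gam) -> Prop) :
  (~ exists L : list (Gam -> Gam), forall phi, P phi -> exists psi, In psi L /\ out_eq Gam phi psi) ->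
  exists phis : nat -> Gam -> Gam,
    (forall n, P (phis n)) /\ forall n m, n <> m -> ~ out_eq Gam (phis n) (phis m).
Proof.
  intros Hno.
  assert (step : forall L : list (Gam -> Gam), exists phi, P phi /\ forall psi, In psi L -> ~ out_eq Gam phi psi).
  { intros L. apply NNPP. intros H. apply Hno. exists L. intros phi Hphi. apply NNPP. intros H'.
    apply H. exists phi. split; [exact Hphi|]. intros psi Hpsi Ho. apply H'. exists psi. auto. }
  destruct (choice _ step) as [nx Hnx].
  (* Each new automorphism avoids the outer classes of all those recorded so far. *)
  set (hist := fix hist n := match n with O => nil | S n => nx (hist n) :: hist n end).
  assert (Hin : forall m n, (m < n)%nat -> In (nx (hist m)) (hist n)).
  { intros m n. induction n as [|n IH]; intros H; [lia|].
    destruct (Nat.eq_dec m n) as [->|Hne]; [left; reflexivity|right; apply IH; lia]. }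
  exists (fun n => nx (hist n)). split; [intros n; apply Hnx|].
  intros n m Hne Ho. destruct (Nat.lt_gt_cases n m) as [H _]. destruct (H Hne).
  - apply (proj2 (Hnx (hist m)) (nx (hist n))); [apply Hin; auto|]. apply out_eq_sym, Ho.
  - apply (proj2 (Hnx (hist n)) (nx (hist m))); [apply Hin; auto|exact Ho].
Qed.

Theorem mainTheorem4 (Gam : Grp) (S : list Gam) (X : MSpace) (A : Gam -> Prop) :
  generates Gam S ->
  hyperbolic_group Gam S ->
  proper_space X -> geodesic_space X -> gromov_hyperbolic X ->
  testable Gam S A ->
  (* open *)
  quot_open Gam S X (S_A Gam S X A) /\
  (* Out(Gam)-invariant: [rho] in S_A -> [rho o phi^-1] in S_A *)
  (forall phi, is_aut Gam phi ->
     forall rho rho' : Rep Gam X, is_rep Gam X rho' ->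
       (forall g x, rho' (phi g) x = rho g x) ->
       S_A Gam S X A rho -> S_A Gam S X A rho') /\
  (* properly discontinuous on compacta *)
  (forall R : Rep Gam X -> Prop,
     saturated Gam X R ->
     (forall rho, R rho -> S_A Gam S X A rho) ->
     quot_compact Gam S X R ->
     exists L : list (Gam -> Gam),
       forall phi, is_aut Gam phi ->
         (exists rho rho', R rho /\ R rho' /\ forall g x, rho' (phi g) x = rho g x) ->
         exists psi, In psi L /\ out_eq Gam phi psi).
Proof.
  intros Gen HGam _ Hgeo HX [HA1 HA2].
  destruct (hyp_with_intro X HX) as [dX HdX].
  destruct (hyp_with_intro _ (cayley_hyperbolic Gam S Gen HGam)) as [dG HdG].
  pose proof (geodesic_chain X Hgeo) as Hch.
  split; [exact (S_A_open Gam S X A Gen dX HdX Hch)|]. split.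
  - intros phi Hphi rho rho' Hr' Heq H. apply (S_A_iff Gam S X A) in H. destruct H as [Hr H].
    destruct (A_stable_stable_at Gam S X A rho H) as (K & C & M & x & HK & HC & HM & Hs).
    destruct (stable_at_aut Gam S X A Gen dG HdG phi rho rho' K C M x Hphi
      ltac:(intros a Ha f Hf; exact (HA1 f Hf a Ha)) Heq Hr HK HC HM Hs)
      as (K' & C' & M' & HK' & HC' & Hs').
    apply S_A_iff. split; [exact Hr'|].
    exact (stable_at_A_stable Gam S X A Gen rho' K' C' M' x Hr' HK' HC' Hs').
  - intros R HRsat HRS HRc.
    destruct (compact_stable_uniform Gam S X A Gen dX HdX Hch R HRS HRc)
      as (K & C & M & HK & HC & HM & Hunif).
    destruct (stable_translation_length Gam S X A Gen dG HdG) as (N0 & K0 & HK0 & Htr).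
    apply NNPP. intros Hno.
    destruct (out_eq_sequence Gam (fun phi => is_aut Gam phi /\
      exists rho rho', R rho /\ R rho' /\ forall g x, rho' (phi g) x = rho g x)) as (phis & Hph & Hdist).
    { intros [L HL]. apply Hno. exists L. intros phi H1 H2. apply HL. auto. }
    destruct (HA2 phis ltac:(intros n; apply Hph) Hdist) as (a & Ha & Hunb).
    (* [B] will bound the displacement of some point by [phis n a], for every [n]: [a] moves the
       base point of [rho] by at most [M] times its length. *)
    set (B := (K * (K0 * (M * INR (wlen Gam S a))))%R).
    (* The bound [N0] provides an axis for [phis n a], and [B + 1] the contradiction. *)
    destruct (Hunb (Rmax (INR N0) (B + 1)) 0%nat) as (n & _ & Hn).
    destruct (Hph n) as (Haut & rho & rho' & Hrho & Hrho' & Heq).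
    destruct (Hunif rho Hrho) as (z & Hz & _). destruct (Hunif rho' Hrho') as (x & Hx).
    assert (Hr : is_rep Gam X rho) by (apply HRsat, Hrho).
    assert (Hr' : is_rep Gam X rho') by (apply HRsat, Hrho').
    destruct (Htr K C M x rho' (phis n a) z HK HM Hr' Hx (HA1 _ Haut a Ha)) as [y Hy].
    { intros g. specialize (Hn g). pose proof (Rmax_l (INR N0) (B + 1)). lra. }
    (* The displacement of [z] under [rho' (phis n a)] becomes that under [rho a]; [z] is the base
       point of [rho], while the stability used is that of [rho'] at [x]. *)
    rewrite Heq in Hy.
    pose proof (rep_displacement Gam S X Gen rho z M a Hr ltac:(lra) Hz) as Hd.
    assert (K * (K0 * dist z (rho a z)) <= B)%R.
    { unfold B. apply Rmult_le_compat_l; [lra|]. apply Rmult_le_compat_l; lra. }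
    specialize (Hn y). pose proof (Rmax_r (INR N0) (B + 1)). lra.
Qed.
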